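(* Let $F_n$ be the free group of finite rank $n$ and let $H$ be a finitely generated subgroup of $F_n$. Then the set $\mathrm{Coc}_{\oplus}(H)$ of $\oplus$-cocycles of $H$ is a context-free subset of $F_n$, and one can effectively compute (from a finite generating set of $H$) a context-free grammar generating it.
   Context: $F_n$ is the free group with basis $A=\{a_1,\dots,a_n\}$; its elements are identified with freely reduced words over the alphabet $A^{\pm}=A\sqcup A^{-1}$. For $H\leqslant F_n$, $\mathrm{Coc}_{\oplus}(H)=\{u\in F_n : \langle H\cup\{u\}\rangle=F_n \text{ and } H\cap\langle u\rangle=\{1\}\}$. A subset $X\subseteq F_n$ is context-free if the set of reduced words representing the elements of $X$ is a context-free language over the alphabet $A^{\pm}$ (i.e. it is generated by a context-free grammar with terminal alphabet $A^{\pm}$). *)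

(* Defs.v *)
From HB Require Import structures.
From Stdlib Require Import Relation_Operators.
From mathcomp Require Import all_boot.

Set Implicit Arguments.
Unset Strict Implicit.
Unset Printing Implicit Defensive.

Local Open Scope group_scope.

(* (i, true) stands for the basis element a_(i+1), (i, false) for its inverse. *)
Notation letter n := ('I_n * bool)%type.

Section FreeGroup.
Variable n : nat.
Implicit Types (x y : letter n) (u v w : seq (letter n)).

Definition inv_letter x : letter n := (x.1, ~~ x.2).

Definition reduced w : bool := sorted (fun x y => y != inv_letter x) w.

Definition push x w : seq (letter n) :=
  if w is y :: w' then (if y == inv_letter x then w' else x :: w) else [:: x].

(* The reduced form of u ++ v, when v is reduced. *)
Definition mul_word u v : seq (letter n) := foldr push v u.

Definition inv_word w : seq (letter n) := rev (map inv_letter w).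

Lemma inv_letterK : involutive inv_letter.
Proof. by case=> i b; rewrite /inv_letter /= negbK. Qed.

Lemma reduced_behead x w : reduced (x :: w) -> reduced w.
Proof. exact: path_sorted. Qed.

Lemma reduced_push x w : reduced w -> reduced (push x w).
Proof.
case: w => [|y w] //= rw; case: ifP => [_|neq]; first exact: path_sorted rw.
by rewrite /= neq.
Qed.

Lemma reduced_mul u v : reduced v -> reduced (mul_word u v).
Proof. by move=> rv; elim: u => //= x u; apply: reduced_push. Qed.

Lemma pushK x w : reduced w -> push (inv_letter x) (push x w) = w.
Proof.
case: w => [|y w] /=; first by rewrite inv_letterK eqxx.
case: eqP => [->|_] rw; last by rewrite /= inv_letterK eqxx.
case: w rw => [|z w] //= /andP[neq _].
by rewrite (negPf neq).
Qed.

Lemma pushVK x w : reduced w -> push x (push (inv_letter x) w) = w.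
Proof. by move=> rw; rewrite -{1}[x]inv_letterK pushK. Qed.

Lemma mul_word_push x v w :
  reduced w -> mul_word (push x v) w = push x (mul_word v w).
Proof.
move=> rw; case: v => [|y v] //=; case: eqP => //= ->.
by rewrite pushVK // reduced_mul.
Qed.

Lemma mul_wordA u v w :
  reduced w -> mul_word u (mul_word v w) = mul_word (mul_word u v) w.
Proof.
by move=> rw; elim: u => //= x u IHu; rewrite mul_word_push // IHu.
Qed.

Lemma mul_word1 w : reduced w -> mul_word w [::] = w.
Proof.
elim: w => //= x w IHw rw; rewrite IHw ?(reduced_behead rw) //.
by case: w rw {IHw} => [|y w] //= /andP[/negPf-> _].
Qed.

Lemma inv_wordK : involutive inv_word.
Proof. by move=> w; rewrite /inv_word map_rev revK mapK //; exact: inv_letterK. Qed.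

Lemma reduced_inv w : reduced w -> reduced (inv_word w).
Proof.
rewrite /reduced /inv_word rev_sorted sorted_map.
by apply: sub_sorted => x y /=; apply: contraNneq => ->; rewrite inv_letterK.
Qed.

Lemma mul_wordV w : mul_word (inv_word w) w = [::].
Proof.
suff H v : reduced v -> mul_word (inv_word w) (mul_word w v) = v.
  have := H [::] isT; rewrite mul_wordA // => e.
  have aux u : mul_word (inv_word u) u = [::]; last exact: aux.
  elim: u => [|x u IHu] //=.
  rewrite /inv_word /= rev_cons -cats1 /mul_word foldr_cat /= inv_letterK eqxx.
  exact: IHu.
move=> rv; elim: w => [|x w IHw] //=.
rewrite /inv_word /= rev_cons -cats1 {1}/mul_word foldr_cat /= pushK //.
exact: reduced_mul.
Qed.

Record free_group : Type := FreeGroup { word :> seq (letter n); _ : reduced word }.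

HB.instance Definition _ := [isSub for word].
HB.instance Definition _ := [Countable of free_group by <:].

Lemma wordP (g : free_group) : reduced (word g).
Proof. exact: valP. Qed.

Definition fg_one : free_group := @FreeGroup [::] isT.
Definition fg_mul (g h : free_group) : free_group :=
  FreeGroup (reduced_mul (word g) (wordP h)).
Definition fg_inv (g : free_group) : free_group :=
  FreeGroup (reduced_inv (wordP g)).

Lemma fg_mulA : associative fg_mul.
Proof. by move=> g h k; apply: val_inj; rewrite /= mul_wordA ?wordP. Qed.

Lemma fg_mul1g : left_id fg_one fg_mul.
Proof. by move=> g; apply: val_inj. Qed.

Lemma fg_mulg1 : right_id fg_one fg_mul.
Proof. by move=> g; apply: val_inj; rewrite /= mul_word1 ?wordP. Qed.

Lemma fg_mulVg : left_inverse fg_one fg_inv fg_mul.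
Proof. by move=> g; apply: val_inj; rewrite /= mul_wordV. Qed.

Lemma fg_mulgV : right_inverse fg_one fg_inv fg_mul.
Proof.
by move=> g; apply: val_inj; rewrite /= -{1}[word g]inv_wordK mul_wordV.
Qed.

HB.instance Definition _ :=
  isGroup.Build free_group fg_mulA fg_mul1g fg_mulg1 fg_mulVg fg_mulgV.

End FreeGroup.

Section Subgroups.
Variable G : groupType.

Record is_subgroup (H : G -> Prop) : Prop := IsSubgroup {
  subgroup1 : H 1;
  subgroupM : forall x y, H x -> H y -> H (x * y);
  subgroupV : forall x, H x -> H x^-1 }.

Definition generated (X : G -> Prop) (g : G) : Prop :=
  forall K : G -> Prop, is_subgroup K -> (forall x, X x -> K x) -> K g.

Definition generated_by (gs : seq G) (H : G -> Prop) : Prop :=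
  forall g, H g <-> generated (fun x => x \in gs) g.

Definition finitely_generated (H : G -> Prop) : Prop :=
  exists gs : seq G, generated_by gs H.

Definition oplus_cocycle (H : G -> Prop) (u : G) : Prop :=
  (forall g, generated (fun x => H x \/ x = u) g) /\
  (forall g, H g /\ generated (fun x => x = u) g <-> g = 1).

End Subgroups.

(* Nonterminals are natural numbers; those of a given grammar are the finitely
   many ones that occur in it. *)
Record grammar (T : Type) : Type := Grammar {
  start : nat;
  productions : seq (nat * seq (nat + T)) }.

Definition grammar_pair (T : Type) (G : grammar T) := (start G, productions G).
Definition pair_grammar (T : Type) (p : nat * seq (nat * seq (nat + T))) :=
  Grammar p.1 p.2.

Lemma grammar_pairK (T : Type) : cancel (@grammar_pair T) (@pair_grammar T).
Proof. by case. Qed.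

HB.instance Definition _ (T : countType) :=
  Countable.copy (grammar T) (can_type (@grammar_pairK T)).

Section Grammars.
Variable T : countType.

Inductive derives1 (G : grammar T) : seq (nat + T) -> seq (nat + T) -> Prop :=
  Derives1 (X : nat) (r u v : seq (nat + T)) of (X, r) \in productions G :
    derives1 G (u ++ inl X :: v) (u ++ r ++ v).

Definition language (G : grammar T) (w : seq T) : Prop :=
  clos_refl_trans _ (derives1 G) [:: inl (start G)] (map inr w).

End Grammars.

Definition generates_subset (n : nat) (G : grammar (letter n))
    (X : free_group n -> Prop) : Prop :=
  forall w : seq (letter n), language G w <-> exists2 g, X g & w = word g.

Definition context_free (n : nat) (X : free_group n -> Prop) : Prop :=
  exists G : grammar (letter n), generates_subset G X.

(* Kleene's total recursive functions; minimization is applied to regular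
   functions only, i.e. those having a zero in the first argument for all values
   of the other ones. *)
Inductive recursive : forall k : nat, (k.-tuple nat -> nat) -> Prop :=
| rec_zero k : recursive (fun _ : k.-tuple nat => 0)
| rec_succ : recursive (fun v : 1.-tuple nat => (thead v).+1)
| rec_proj k (i : 'I_k) : recursive (fun v : k.-tuple nat => tnth v i)
| rec_comp k m (f : m.-tuple nat -> nat) (g : 'I_m -> k.-tuple nat -> nat) :
    recursive f -> (forall i, recursive (g i)) ->
    recursive (fun v => f [tuple g i v | i < m])
| rec_prim k (f : k.-tuple nat -> nat) (g : k.+2.-tuple nat -> nat)
    (h : k.+1.-tuple nat -> nat) :
    recursive f -> recursive g ->
    (forall v : k.-tuple nat, h (cons_tuple 0 v) = f v) ->
    (forall (y : nat) (v : k.-tuple nat),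
       h (cons_tuple y.+1 v) =
       g (cons_tuple y (cons_tuple (h (cons_tuple y v)) v))) ->
    recursive h
| rec_mu k (f : k.+1.-tuple nat -> nat) (h : k.-tuple nat -> nat) :
    recursive f ->
    (forall v : k.-tuple nat, f (cons_tuple (h v) v) = 0) ->
    (forall (v : k.-tuple nat) (y : nat), y < h v -> f (cons_tuple y v) <> 0) ->
    recursive h
| rec_ext k (f h : k.-tuple nat -> nat) :
    recursive f -> (forall v, h v = f v) -> recursive h.

(* Functions between coded data types, relative to the codes given by pickle.
   This is meaningful for types built from nat, 'I_n and bool by products, sums,
   sequences and decidable subtypes, for which pickle is an explicit coding. *)
Definition computable (T U : countType) (f : T -> U) : Prop :=
  exists2 g : 1.-tuple nat -> nat,
    recursive g & forall x, g [tuple pickle x] = pickle (f x).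

(* Main.v *)
Require Import Defs.
From Stdlib Require Import Relation_Operators.
From mathcomp Require Import all_boot boolp.

(** Let Gamma be a finite partial action of F_n on coset representatives, with
    base point 1, whose stabilizer is H and in which every letter can be read at
    1. If <H, u> = F_n, then u = p q where q and p^-1 can both be read from 1:
    otherwise the unreadable middle part of u could be attached to Gamma as an
    arc, and the stabilizer of 1 in the extended action would be a proper
    subgroup containing H and u. If q leads to the coset a H and p^-1 to b H,
    then u lies in H b^-1 a H, so <H, u> = <H, b^-1 a> and only finitely many
    pairs (a, b) have to be tested.

    Write u = s^-1 w s with w cyclically reduced. The splitting can be moved into
    w, and, if x is the state reached by s, a power of u lies in H if and only if
    x is a periodic point of the partial injection induced by w. A linear grammar
    generating s^-1 w1 w2 s from outside to inside only has to remember the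
    actions on the states, the end letters and the reducedness of s, w1 and w2.

    The action Gamma is found by unbounded search for a table in which every edge
    carries an expression of its label in the given generators; such a table
    exists because the cosets of the suffixes of the generators form one. *)

Set Implicit Arguments.
Unset Strict Implicit.
Unset Printing Implicit Defensive.

(** * Recursive functions on codes *)

(** That every letter can be read at 1 is what closes the arc argument. If the extended action is
    fixed at 1 by all of F_n, then each edge of Gamma at 1 is a loop, so that every word could be
    read at 1 from the beginning and nothing was unreadable. With H trivial in rank 1, the table
    without edges would merely turn u = a_1 into a loop, and no contradiction would arise.

    Searching for a table avoids programming the folding of graphs with Kleene's functions. The only
    property of a table that is not evidently decidable is that its labels lie in H, and the
    expressions carried by the edges make it checkable; that some table exists may then be proved
    classically. The same search for the generators together with b^-1 a decides whether <H, b^-1 a>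
    = F_n, namely whether every letter is a loop at 1.

    As w is cyclically reduced, s^-1 w^k s is the reduced word of u^k for k > 0, so that all powers
    of u are controlled by one partial injection of a finite set. The factors s^-1 and s have to
    match letter by letter, hence a grammar that grows on both sides. *)

Definition recursive1 (f : nat -> nat) :=
  forall k (g : k.-tuple nat -> nat),
    recursive g -> recursive (fun v => f (g v)).
Definition recursive2 (f : nat -> nat -> nat) :=
  forall k (g1 g2 : k.-tuple nat -> nat),
    recursive g1 -> recursive g2 -> recursive (fun v => f (g1 v) (g2 v)).
Definition recursive3 (f : nat -> nat -> nat -> nat) :=
  forall k (g1 g2 g3 : k.-tuple nat -> nat),
    recursive g1 -> recursive g2 -> recursive g3 ->
    recursive (fun v => f (g1 v) (g2 v) (g3 v)).

Lemma recursive_comp (m : nat) (F : m.-tuple nat -> nat) (k : nat)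
    (g : 'I_m -> k.-tuple nat -> nat) (f : k.-tuple nat -> nat) :
  recursive F -> (forall i, recursive (g i)) ->
  (forall v, f v = F [tuple g i v | i < m]) -> recursive f.
Proof. by move=> rF rg ef; apply: rec_ext (rec_comp rF rg) ef. Qed.

(** [recursive1] quantifies over a substituted function of any arity, so that closure lemmas compose
    without reindexing tuples. Substitution into the coordinate function is the general case. *)
Lemma recursive1P (f : nat -> nat) :
  recursive (fun v : 1.-tuple nat => f (tnth v ord0)) -> recursive1 f.
Proof.
move=> rf k g rg; apply: (recursive_comp (g := fun=> g) rf) => // v.
by rewrite tnth_mktuple.
Qed.

Lemma recursive2P (f : nat -> nat -> nat) :
  recursive (fun v : 2.-tuple nat => f (tnth v ord0) (tnth v (lift ord0 ord0))) ->
  recursive2 f.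
Proof.
move=> rf k g1 g2 r1 r2.
apply: (recursive_comp (g := fun i => if i == ord0 then g1 else g2) rf).
  by move=> i; case: ifP.
by move=> v; rewrite !tnth_mktuple.
Qed.

Lemma recursive1_succ : recursive1 succn.
Proof. exact: (recursive1P rec_succ). Qed.

Lemma recursive_const k m : recursive (fun _ : k.-tuple nat => m).
Proof. by elim: m => [|m IHm]; [exact: rec_zero | exact: recursive1_succ]. Qed.

Lemma recursive2_iteri (z : nat -> nat) (g : nat -> nat -> nat -> nat) :
  recursive1 z -> recursive3 g ->
  recursive2 (fun y x => iteri y (fun i r => g i r x) (z x)).
Proof.
move=> rz rg; apply: recursive2P.
have rz' := rz _ _ (rec_proj (ord0 : 'I_1)).
have rg' := rg _ _ _ _ (rec_proj (ord0 : 'I_3)) (rec_proj (lift ord0 ord0))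
  (rec_proj (lift ord0 (lift ord0 ord0))).
apply: (rec_prim rz' rg') => [v|y v].
  by rewrite !(tnth_nth 0).
by rewrite !(tnth_nth 0).
Qed.

Lemma recursive1_mu (f : nat -> nat -> nat) (h : nat -> nat) :
  recursive2 f -> (forall x, f (h x) x = 0) ->
  (forall x y, y < h x -> f y x <> 0) -> recursive1 h.
Proof.
move=> rf h0 hmin; apply: recursive1P.
have rf' := rf _ _ _ (rec_proj (ord0 : 'I_2)) (rec_proj (lift ord0 ord0)).
apply: (rec_mu rf') => [v|v y]; rewrite !(tnth_nth 0) /=; first exact: h0.
exact: hmin.
Qed.

Lemma recursive1_comp f g :
  recursive1 f -> recursive1 g -> recursive1 (fun x => f (g x)).
Proof. by move=> rf rg k h rh; apply: rf; apply: rg. Qed.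

Lemma recursive1_ext f g : f =1 g -> recursive1 f -> recursive1 g.
Proof. by move=> fg rf k h rh; apply: rec_ext (rf _ _ rh) _ => v; rewrite fg. Qed.

Lemma recursive2_ext f g : f =2 g -> recursive2 f -> recursive2 g.
Proof.
move=> fg rf k h h' rh rh'.
by apply: rec_ext (rf _ _ _ rh rh') _ => v; rewrite fg.
Qed.

Lemma recursive2_addn : recursive2 addn.
Proof.
apply: (recursive2_ext _ (@recursive2_iteri id (fun _ r _ => r.+1) _ _)).
- by elim=> [|y IHy] x //=; rewrite IHy.
- by move=> k g rg.
- by move=> k g1 g2 g3 _ r2 _; apply: recursive1_succ.
Qed.

Lemma recursive2_muln : recursive2 muln.
Proof.
apply: (recursive2_ext _
  (@recursive2_iteri (fun=> 0) (fun _ r x => x + r) _ _)).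
- by elim=> [|y IHy] x //=; rewrite IHy mulSn.
- by move=> k g rg; apply: recursive_const.
- by move=> k g1 g2 g3 _ r2 r3; apply: recursive2_addn.
Qed.

Lemma recursive1_expn2 : recursive1 (expn 2).
Proof.
have r : recursive2 (fun y _ => 2 ^ y).
  apply: (recursive2_ext _
    (@recursive2_iteri (fun=> 1) (fun _ r _ => r + r) _ _)).
  - by elim=> [|y IHy] x //=; rewrite IHy // expnS mul2n addnn.
  - by move=> k g rg; apply: recursive_const.
  - by move=> k g1 g2 g3 _ r2 _; apply: recursive2_addn.
by move=> k g rg; apply: r rg (recursive_const _ 0).
Qed.

Lemma recursive1_pred : recursive1 predn.
Proof.
have r : recursive2 (fun y _ => y.-1).
  apply: (recursive2_ext _ (@recursive2_iteri (fun=> 0) (fun i _ _ => i) _ _)).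
  - by case.
  - by move=> k g rg; apply: recursive_const.
  - by move=> k g1 g2 g3 r1.
by move=> k g rg; apply: r rg (recursive_const _ 0).
Qed.

Lemma recursive2_subn : recursive2 subn.
Proof.
have r : recursive2 (fun y x => x - y).
  apply: (recursive2_ext _ (@recursive2_iteri id (fun _ r _ => r.-1) _ _)).
  - by elim=> [|y IHy] x /=; rewrite ?subn0 // subnS IHy.
  - by move=> k g rg.
  - by move=> k g1 g2 g3 _ r2 _; apply: recursive1_pred.
by move=> k g1 g2 r1 r2; apply: r r2 r1.
Qed.

Lemma recursive2_eqn : recursive2 (fun x y => x == y :> nat).
Proof.
have r : recursive2 (fun x y => 1 - ((x - y) + (y - x))).
  move=> k g1 g2 r1 r2; apply: recursive2_subn; first exact: recursive_const.
  by apply: recursive2_addn; apply: recursive2_subn.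
apply: (recursive2_ext _ r) => x y.
rewrite eqn_leq -!subn_eq0 -addn_eq0.
by case: (_ + _).
Qed.

Lemma recursive3_if : recursive3 (fun b x y => if b != 0 then x else y).
Proof.
have r : recursive3 (fun b x y => (1 - (b == 0)) * x + (b == 0) * y).
  move=> k g1 g2 g3 r1 r2 r3.
  have r0 : recursive (fun v => g1 v == 0 : nat).
    by apply: recursive2_eqn r1 (recursive_const _ _).
  apply: recursive2_addn; apply: recursive2_muln => //.
  by apply: recursive2_subn => //; apply: recursive_const.
move=> k g1 g2 g3 r1 r2 r3; apply: rec_ext (r _ _ _ _ r1 r2 r3) _ => v.
by case: (g1 v == 0); rewrite ?mul1n ?addn0.
Qed.

Lemma recursive1_odd : recursive1 (fun y => odd y).
Proof.
have r : recursive2 (fun y _ => odd y).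
  apply: (recursive2_ext _ (@recursive2_iteri (fun=> 0) (fun _ r _ => 1 - r) _ _)).
  - by elim=> //= y IHy x; rewrite IHy //; case: (odd y).
  - by move=> k g rg; apply: recursive_const.
  - move=> k g1 g2 g3 _ r2 _; apply: recursive2_subn => //.
    exact: recursive_const.
by move=> k g rg; apply: r rg (recursive_const _ 0).
Qed.

Lemma recursive1_half : recursive1 half.
Proof.
have r : recursive2 (fun y _ => y./2).
  apply: (recursive2_ext _
    (@recursive2_iteri (fun=> 0) (fun i r _ => odd i + r) _ _)).
  - by elim=> //= y IHy x; rewrite IHy // uphalf_half.
  - by move=> k g rg; apply: recursive_const.
  - move=> k g1 g2 g3 r1 r2 _; apply: recursive2_addn => //.
    exact: recursive1_odd.
by move=> k g rg; apply: r rg (recursive_const _ 0).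
Qed.

Lemma recursive2_iter_half : recursive2 (fun y x => iter y half x).
Proof.
apply: (recursive2_ext _ (@recursive2_iteri id (fun _ r _ => r./2) _ _)).
- by elim=> [|y IHy] x //=; rewrite IHy.
- by move=> k g.
- by move=> k g1 g2 g3 _ r2 _; apply: recursive1_half.
Qed.

(** The step of [CodeSeq.code]: the head is the exponent of 2 and the tail is read off from the odd
    part. *)
Definition code_cons x c := 2 ^ x * c.*2.+1.
Definition code_head c := head 0 (CodeSeq.decode c).
Definition code_tail c := CodeSeq.code (behead (CodeSeq.decode c)).

Lemma recursive2_code_cons : recursive2 code_cons.
Proof.
move=> k g1 g2 r1 r2; apply: recursive2_muln; first exact: recursive1_expn2.
have r : recursive (fun v => (g2 v + g2 v).+1).
  by apply: recursive1_succ; apply: recursive2_addn.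
by apply: rec_ext r _ => v; rewrite addnn.
Qed.

Lemma iter_half_code i x c : i <= x ->
  iter i half (code_cons x c) = code_cons (x - i) c.
Proof.
elim: i => [|i IHi] ltix; first by rewrite subn0.
rewrite iterS IHi 1?ltnW //.
have ->: x - i = (x - i.+1).+1 by rewrite subnSK.
by rewrite /code_cons expnS -mulnA mul2n doubleK.
Qed.

Lemma code_casesP c :
  c = 0 /\ CodeSeq.decode c = [::] \/
  c = code_cons (code_head c) (code_tail c).
Proof.
rewrite /code_head /code_tail -[c]CodeSeq.decodeK CodeSeq.codeK.
by case: (CodeSeq.decode c) => [|x s] /=; [left | right].
Qed.

Lemma recursive1_code_head : recursive1 code_head.
Proof.
(* The head is the least number of halvings that leads to an odd number. The guard makes the search
   stop at once on 0, the code of the empty list. *)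
apply: (@recursive1_mu (fun y x => (x != 0) && ~~ odd (iter y half x))).
- move=> k g1 g2 r1 r2.
  have r : recursive (fun v =>
      if g2 v != 0 then 1 - odd (iter (g1 v) half (g2 v)) else 0).
    apply: recursive3_if => //; last exact: recursive_const.
    apply: recursive2_subn; first exact: recursive_const.
    by apply: recursive1_odd; apply: recursive2_iter_half.
  apply: rec_ext r _ => v; case: ifP => //= _.
  by case: (odd _).
- move=> c; case: (code_casesP c) => [[-> _]|{1 3}->] //.
  by rewrite iter_half_code // subnn /code_cons expn0 mul1n /= odd_double andbF.
- move=> c y; case: (code_casesP c) => [[-> _]|] //.
  move: (code_head c) (code_tail c) => x d -> ltyx.
  rewrite iter_half_code 1?ltnW // -subnSK // /code_cons expnS -mulnA.
  by rewrite mul2n odd_double -!mul2n !muln_eq0 expn_eq0.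
Qed.

Lemma recursive1_code_tail : recursive1 code_tail.
Proof.
apply: (@recursive1_ext (fun c => half (iter (code_head c) half c))).
  move=> c; case: (code_casesP c) => [[-> _]|]; first by [].
  move: (code_head c) (code_tail c) => x d ->.
  by rewrite iter_half_code // subnn /code_cons expn0 mul1n /= uphalf_double.
move=> k g rg; apply: recursive1_half; apply: recursive2_iter_half => //.
exact: recursive1_code_head.
Qed.

(** * Closure properties of computable functions *)

Lemma computableI (T U : countType) (f : T -> U) (g : nat -> nat) :
  recursive1 g -> (forall x, g (pickle x) = pickle (f x)) -> computable f.
Proof.
move=> rg gf; exists (fun v => g (tnth v ord0)); last by move=> x; apply: gf.
exact: rg (rec_proj _).
Qed.

Lemma computableE (T U : countType) (f : T -> U) :
  computable f ->
  exists2 g, recursive1 g & forall x, g (pickle x) = pickle (f x).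
Proof.
case=> g rg gf; exists (fun x => g [tuple x]) => // k h rh.
apply: (recursive_comp (g := fun=> h) rg) => // v.
congr (g _); apply: eq_from_tnth => i.
by rewrite tnth_mktuple (tnth_nth 0) /= (ord1 i).
Qed.

Lemma computable_ext (T U : countType) (f g : T -> U) :
  f =1 g -> computable f -> computable g.
Proof. by move=> fg [h rh hf]; exists h => // x; rewrite hf fg. Qed.

Lemma recursive1_id : recursive1 id.
Proof. by []. Qed.

Lemma recursive1_const m : recursive1 (fun=> m).
Proof. by move=> k g _; apply: recursive_const. Qed.

Lemma computable_comp (C T U : countType) (f : T -> U) (a : C -> T) :
  computable f -> computable a -> computable (fun c => f (a c)).
Proof.
move=> /computableE[f' rf ff'] /computableE[a' ra aa'].
by apply: (computableI (recursive1_comp rf ra)) => c; rewrite aa' ff'.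
Qed.

Lemma pickle_pair (T U : countType) (x : T) (y : U) :
  pickle (x, y) = CodeSeq.code [:: pickle x; pickle y].
Proof. by []. Qed.

Lemma pickle_cons (T : countType) (x : T) (s : seq T) :
  pickle (x :: s) = CodeSeq.code (pickle x :: map pickle s).
Proof. by []. Qed.

Definition code_pair x y := code_cons x (code_cons y 0).

Lemma recursive2_code_pair : recursive2 code_pair.
Proof.
move=> k g1 g2 r1 r2; apply: recursive2_code_cons => //.
by apply: recursive2_code_cons => //; apply: recursive_const.
Qed.

Section Basics.
Variables C T U : countType.

Lemma computable_id : computable (fun c : C => c).
Proof. exact: (computableI recursive1_id). Qed.

Lemma computable_const (x : T) : computable (fun _ : C => x).
Proof. exact: (computableI (recursive1_const (pickle x))). Qed.

Lemma computable_pair (a : C -> T) (b : C -> U) :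
  computable a -> computable b -> computable (fun c => (a c, b c)).
Proof.
move=> /computableE[a' ra aa'] /computableE[b' rb bb'].
apply: (@computableI _ _ _ (fun x => code_pair (a' x) (b' x))).
  by move=> k g rg; apply: recursive2_code_pair; [exact: ra | exact: rb].
by move=> c; rewrite aa' bb'.
Qed.

Lemma computable_fst (a : C -> T * U) :
  computable a -> computable (fun c => (a c).1).
Proof.
apply: (@computable_comp _ _ _ fst); apply: (computableI recursive1_code_head) => -[x y].
by rewrite pickle_pair /code_head CodeSeq.codeK.
Qed.

Lemma computable_snd (a : C -> T * U) :
  computable a -> computable (fun c => (a c).2).
Proof.
apply: (@computable_comp _ _ _ snd).
apply: (computableI
  (recursive1_comp recursive1_code_head recursive1_code_tail)) => -[x y].
by rewrite pickle_pair /code_head /code_tail !CodeSeq.codeK.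
Qed.

Lemma computable_same_code (f : T -> U) (a : C -> T) :
  (forall x, pickle (f x) = pickle x) ->
  computable a -> computable (fun c => f (a c)).
Proof.
by move=> fE; apply: (computable_comp (f := f)); apply: (computableI recursive1_id).
Qed.

Lemma computable_nat1 (f : nat -> nat) (a : C -> nat) :
  recursive1 f -> computable a -> computable (fun c => f (a c)).
Proof. by move=> rf; apply: (computable_comp (f := f)); apply: (computableI rf). Qed.

Lemma computable_pickle (a : C -> T) :
  computable a -> computable (fun c => pickle (a c)).
Proof.
by apply: (computable_comp (f := pickle)); apply: (computableI recursive1_id).
Qed.

Lemma computable_if (b : C -> bool) (f g : C -> T) :
  computable b -> computable f -> computable g ->
  computable (fun c => if b c then f c else g c).
Proof.
move=> /computableE[b' rb bb'] /computableE[f' rf ff'] /computableE[g' rg gg'].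
apply: (@computableI _ _ _ (fun x => if b' x != 0 then f' x else g' x)).
  by move=> k h rh; apply: recursive3_if; [exact: rb | exact: rf | exact: rg].
by move=> c; rewrite bb' ff' gg'; case: (b c).
Qed.

Lemma computable_eq (a b : C -> T) :
  computable a -> computable b -> computable (fun c => a c == b c).
Proof.
move=> /computableE[a' ra aa'] /computableE[b' rb bb'].
apply: (@computableI _ _ _ (fun x => a' x == b' x : nat)).
  by move=> k h rh; apply: recursive2_eqn; [exact: ra | exact: rb].
by move=> c; rewrite aa' bb' (inj_eq (pcan_inj pickleK)).
Qed.

End Basics.

Section Boolean.
Variable C : countType.
Implicit Types a b : C -> bool.

Lemma computable_andb a b :
  computable a -> computable b -> computable (fun c => a c && b c).
Proof. by move=> ca cb; apply: computable_if cb (computable_const _ _). Qed.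

Lemma computable_orb a b :
  computable a -> computable b -> computable (fun c => a c || b c).
Proof. by move=> ca cb; apply: computable_if (computable_const _ _) cb. Qed.

Lemma computable_negb a : computable a -> computable (fun c => ~~ a c).
Proof.
by move=> ca; apply: computable_if (computable_const _ _) (computable_const _ _).
Qed.

End Boolean.

Section Recursion.
Variables C T U : countType.

Lemma computable_iteri (m : C -> nat) (z : C -> U) (g : C -> nat -> U -> U) :
  computable m -> computable z ->
  computable (fun p : C * nat * U => g p.1.1 p.1.2 p.2) ->
  computable (fun c => iteri (m c) (g c) (z c)).
Proof.
move=> /computableE[m' rm mm'] /computableE[z' rz zz'] /computableE[g' rg gg'].
apply: (@computableI _ _ _
    (fun x => iteri (m' x) (fun i r => g' (code_pair (code_pair x i) r)) (z' x))).
  move=> k h rh.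
  apply: (@recursive2_iteri z' (fun i r x => g' (code_pair (code_pair x i) r))) => //.
    by move=> k' g1 g2 g3 r1 r2 r3; apply: rg; do 2?[apply: recursive2_code_pair => //].
  exact: rm.
(* A natural number is its own code, so the code of the bound can serve as the number of
   iterations. *)
move=> c; rewrite mm' zz'; change (pickle (m c)) with (m c).
by elim: (m c) => //= i ->; rewrite -(gg' (c, i, _)).
Qed.

Lemma computable_iter (m : C -> nat) (z : C -> U) (g : C -> U -> U) :
  computable m -> computable z -> computable (fun p : C * U => g p.1 p.2) ->
  computable (fun c => iter (m c) (g c) (z c)).
Proof.
move=> cm cz cg.
apply: (computable_ext _ (@computable_iteri m z (fun c _ => g c) cm cz _)).
  by move=> c; elim: (m c) => //= i ->.
have cp : computable (fun p : C * nat * U => (p.1.1, p.2)).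
  apply: computable_pair (computable_snd (computable_id _)).
  exact: computable_fst (computable_fst (computable_id _)).
exact: computable_comp cg cp.
Qed.

Lemma computable_seq_case (s : C -> seq T) (z : C -> U)
    (f : C -> T -> seq T -> U) :
  computable s -> computable z ->
  computable (fun p : C * T * seq T => f p.1.1 p.1.2 p.2) ->
  computable (fun c => if s c is x :: s' then f c x s' else z c).
Proof.
move=> /computableE[s' rs ss'] /computableE[z' rz zz'] /computableE[f' rf ff'].
apply: (@computableI _ _ _ (fun x => if s' x != 0 then
   f' (code_pair (code_pair x (code_head (s' x))) (code_tail (s' x))) else z' x)).
  move=> k h rh; apply: recursive3_if; [exact: rs| |exact: rz].
  apply: rf; apply: recursive2_code_pair; last exact/recursive1_code_tail/rs.
  by apply: recursive2_code_pair => //; apply/recursive1_code_head/rs.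
move=> c; rewrite ss' zz'; case: (s c) => [|x t] //.
rewrite pickle_cons /code_head /code_tail CodeSeq.codeK /= -(ff' (c, x, t)).
by case: eqP => // /eqP; rewrite muln_eq0 expn_eq0.
Qed.

Lemma computable_cons (a : C -> T) (s : C -> seq T) :
  computable a -> computable s -> computable (fun c => a c :: s c).
Proof.
move=> /computableE[a' ra aa'] /computableE[s' rs ss'].
apply: (@computableI _ _ _ (fun x => code_cons (a' x) (s' x))).
  by move=> k h rh; apply: recursive2_code_cons; [exact: ra | exact: rs].
by move=> c; rewrite aa' ss'.
Qed.

End Recursion.

Lemma computable_comp2 (C T U V : countType) (f : T -> U -> V)
    (a : C -> T) (b : C -> U) :
  computable (fun p : T * U => f p.1 p.2) -> computable a -> computable b ->
  computable (fun c => f (a c) (b c)).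
Proof. by move=> cf ca cb; apply: computable_comp cf (computable_pair ca cb). Qed.

Lemma computable_comp3 (C T U V W : countType) (f : T -> U -> V -> W)
    (a : C -> T) (b : C -> U) (d : C -> V) :
  computable (fun p : T * U * V => f p.1.1 p.1.2 p.2) ->
  computable a -> computable b -> computable d ->
  computable (fun c => f (a c) (b c) (d c)).
Proof.
move=> cf ca cb cd.
exact: computable_comp cf (computable_pair (computable_pair ca cb) cd).
Qed.

(** Each rule is the closure lemma for the head symbol of the body, and hypotheses on function
    variables serve as rules too. [computability] is redefined whenever further closure lemmas
    become available. *)
Ltac computability_step :=
  match goal with
  | |- computable (fun c => c) => exact: computable_id
  | |- computable (fun _ => ?x) => exact: (computable_const _ x)
  | h : computable ?f |- computable ?f => exact: h
  | h : computable ?f |- computable (fun c => ?f (@?a c)) =>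
    exact: h || apply: (computable_comp (f := f) (a := a) h)
  | h : computable (fun p => ?f (fst p) (snd p)) |- computable (fun c => ?f _ _) =>
    apply: (computable_comp2 h)
  | h : computable (fun p => ?f (fst (fst p)) (snd (fst p)) (snd p))
      |- computable (fun c => ?f _ _ _) => apply: (computable_comp3 h)
  | |- computable fst => exact: computable_fst (computable_id _)
  | |- computable pickle => exact: computable_pickle (computable_id _)
  | |- computable snd => exact: computable_snd (computable_id _)
  | |- computable (fun c => (_, _)) => apply: computable_pair
  | |- computable (fun c => fst _) => apply: computable_fst
  | |- computable (fun c => snd _) => apply: computable_snd
  | |- computable (fun c => eq_op _ _) => apply: computable_eq
  | |- computable (fun c => andb _ _) => apply: computable_andb
  | |- computable (fun c => orb _ _) => apply: computable_orb
  | |- computable (fun c => negb _) => apply: computable_negb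
  | |- computable (fun c => if _ then _ else _) => apply: computable_if
  | |- computable (fun c => pickle _) => apply: computable_pickle
  | |- computable (fun c => iter _ _ _) => apply: computable_iter
  | |- computable (fun c => cons _ _) => apply: computable_cons
  | |- computable (fun c => match _ with [::] => _ | _ :: _ => _ end) =>
    apply: computable_seq_case
  end.
Ltac computability := repeat (cbv beta; computability_step).

Section Lists.
Variables C T U : countType.

(** Provides a bound, available without computing the length, for the number of steps that exhaust a
    list. *)
Lemma size_leq_code (s : seq nat) : size s <= CodeSeq.code s.
Proof.
elim: s => //= x s IHs.
apply: (@leq_trans (CodeSeq.code s).*2.+1); last by rewrite leq_pmull ?expn_gt0.
by rewrite ltnS (leq_trans IHs) // -addnn leq_addr.
Qed.

(** A fold iterates a step on pairs of a remaining list and an accumulator. Exhausted pairs are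
    fixed points, so iterating as often as the code of the list says does no harm. *)
Lemma computable_foldl (s : C -> seq T) (z : C -> U) (g : C -> U -> T -> U) :
  computable s -> computable z ->
  computable (fun p : C * U * T => g p.1.1 p.1.2 p.2) ->
  computable (fun c => foldl (g c) (z c) (s c)).
Proof.
move=> cs cz cg.
pose st c (p : seq T * U) := if p.1 is x :: t then (t, g c p.2 x) else p.
have iterE c p : forall m, size p.1 <= m ->
    (iter m (st c) p).2 = foldl (g c) p.2 p.1.
  move=> m; elim: m p => [|m IHm] [[|x t] r] //=.
    by move=> _; rewrite -iterS iterSr; apply: (IHm ([::], r)).
  by rewrite ltnS -iterS iterSr => le_tm; rewrite IHm.
apply: (@computable_ext _ _
  (fun c => (iter (pickle (s c)) (st c) (s c, z c)).2)).
  move=> c; rewrite iterE //=.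
  by rewrite -(size_map pickle) size_leq_code.
apply: computable_snd; apply: computable_iter.
- exact: computable_pickle.
- exact: computable_pair.
computability; rewrite /st; computability.
Qed.

End Lists.

Lemma computable_rev (C T : countType) (s : C -> seq T) :
  computable s -> computable (fun c => rev (s c)).
Proof.
move=> cs; apply: (@computable_ext _ _
    (fun c => foldl (fun r x => x :: r) [::] (s c))).
  by move=> c; rewrite /rev; elim: (s c) [::] => //=.
by apply: (computable_foldl (g := fun _ r x => x :: r)); computability.
Qed.

Lemma computable_foldr (C T U : countType) (s : C -> seq T) (z : C -> U)
    (g : C -> T -> U -> U) :
  computable s -> computable z ->
  computable (fun p : C * T * U => g p.1.1 p.1.2 p.2) ->
  computable (fun c => foldr (g c) (z c) (s c)).
Proof.
move=> cs cz cg; apply: (@computable_ext _ _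
    (fun c => foldl (fun r x => g c x r) (z c) (rev (s c)))).
  by move=> c; rewrite foldl_rev.
apply: (computable_foldl (g := fun c r x => g c x r)) => //.
  exact: computable_rev.
by computability.
Qed.

Lemma computable_behead (C T : countType) (s : C -> seq T) :
  computable s -> computable (fun c => behead (s c)).
Proof. by move=> cs; rewrite /behead; computability. Qed.

Section MoreLists.
Variables C T U : countType.
Implicit Types s t : C -> seq T.

Lemma computable_cat s t :
  computable s -> computable t -> computable (fun c => s c ++ t c).
Proof.
move=> cs ct; apply: (@computable_ext _ _
    (fun c => foldr (fun x r => x :: r) (t c) (s c))).
  by move=> c; elim: (s c) => //= x r ->.
by apply: (computable_foldr (g := fun _ x r => x :: r)) => //; computability.
Qed.

Lemma computable_map s (f : C -> T -> U) :
  computable s -> computable (fun p : C * T => f p.1 p.2) ->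
  computable (fun c => [seq f c x | x <- s c]).
Proof.
move=> cs cf.
apply: (computable_foldr (g := fun c x r => f c x :: r)) => //; computability.
Qed.

Lemma computable_filter s (f : C -> T -> bool) :
  computable s -> computable (fun p : C * T => f p.1 p.2) ->
  computable (fun c => [seq x <- s c | f c x]).
Proof.
move=> cs cf.
apply: (computable_foldr (g := fun c x r => if f c x then x :: r else r)) => //.
  by computability.
computability.
Qed.

Lemma computable_all s (f : C -> T -> bool) :
  computable s -> computable (fun p : C * T => f p.1 p.2) ->
  computable (fun c => all (f c) (s c)).
Proof.
move=> cs cf.
apply: (computable_foldr (g := fun c x r => f c x && r)) => //; computability.
Qed.

Lemma computable_has s (f : C -> T -> bool) :
  computable s -> computable (fun p : C * T => f p.1 p.2) ->
  computable (fun c => has (f c) (s c)).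
Proof.
move=> cs cf.
apply: (computable_foldr (g := fun c x r => f c x || r)) => //; computability.
Qed.

Lemma computable_find s (f : C -> T -> bool) :
  computable s -> computable (fun p : C * T => f p.1 p.2) ->
  computable (fun c => find (f c) (s c)).
Proof.
move=> cs cf.
apply: (computable_foldr (g := fun c x r => if f c x then 0 else r.+1)) => //.
  by computability.
computability.
by apply: (computable_nat1 recursive1_succ); computability.
Qed.

Lemma computable_mem (a : C -> T) s :
  computable a -> computable s -> computable (fun c => a c \in s c).
Proof.
move=> ca cs; apply: (@computable_ext _ _
    (fun c => has (fun x => x == a c) (s c))).
  by move=> c; rewrite has_pred1.
apply: (computable_has (f := fun c x => x == a c)) => //; computability.
Qed.

Lemma computable_size s : computable s -> computable (fun c => size (s c)).
Proof.
move=> cs; apply: (computable_foldr (g := fun _ _ r => r.+1)) => //.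
  by computability.
by apply: (computable_nat1 recursive1_succ); computability.
Qed.

Lemma computable_head (x0 : C -> T) s :
  computable x0 -> computable s -> computable (fun c => head (x0 c) (s c)).
Proof. by move=> cx cs; rewrite /head; computability. Qed.

Lemma computable_nth (x0 : C -> T) s (m : C -> nat) :
  computable x0 -> computable s -> computable m ->
  computable (fun c => nth (x0 c) (s c) (m c)).
Proof.
move=> cx cs cm; apply: (@computable_ext _ _
    (fun c => head (x0 c) (iter (m c) behead (s c)))).
  move=> c; rewrite -nth0 -[m c in RHS]addn0 -nth_drop; congr (nth _ _ 0).
  elim: (m c) => [|i IHi] /=; first by rewrite drop0.
  by rewrite IHi -drop1 drop_drop.
apply: computable_head => //.
apply: (computable_iter (g := fun _ => behead)) => //.
by apply: computable_behead; computability.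
Qed.

End MoreLists.

Lemma computable_flatten (C T : countType) (s : C -> seq (seq T)) :
  computable s -> computable (fun c => flatten (s c)).
Proof.
move=> cs; apply: (computable_foldr (g := fun _ => cat)) => //.
  by computability.
by apply: computable_cat; computability.
Qed.

Ltac computability_list_step :=
  match goal with
  | |- computable (fun c => cat _ _) => apply: computable_cat
  | |- computable (fun c => map _ _) => apply: computable_map
  | |- computable (fun c => filter _ _) => apply: computable_filter
  | |- computable (fun c => all _ _) => apply: computable_all
  | |- computable (fun c => has _ _) => apply: computable_has
  | |- computable (fun c => find _ _) => apply: computable_find
  | |- computable (fun c => in_mem _ _) => apply: computable_mem
  | |- computable (fun c => size _) => apply: computable_size
  | |- computable (fun c => behead _) => apply: computable_behead
  | |- computable (fun c => head _ _) => apply: computable_head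
  | |- computable (fun c => nth _ _ _) => apply: computable_nth
  | |- computable (fun c => flatten _) => apply: computable_flatten
  | |- computable (fun c => rev _) => apply: computable_rev
  | |- computable (fun c => foldr _ _ _) => apply: computable_foldr
  end.
Ltac computability ::=
  repeat (cbv beta; first [computability_list_step | computability_step]).

Section Options.
Variables C T U : countType.

(** An option has the code of a list with at most one entry, and an element of a sum that of a pair
    of such lists; hence these closure properties are those of lists up to conversion. *)
Lemma computable_option_case (a : C -> option T) (z : C -> U) (f : C -> T -> U) :
  computable a -> computable z -> computable (fun p : C * T => f p.1 p.2) ->
  computable (fun c => if a c is Some x then f c x else z c).
Proof.
move=> ca cz cf; apply: (@computable_ext _ _
    (fun c => if seq_of_opt (a c) is x :: _ then f c x else z c)).
  by move=> c; case: (a c).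
by apply: (computable_seq_case (f := fun c x _ => f c x)) => //; computability.
Qed.

Lemma computable_Some (a : C -> T) :
  computable a -> computable (fun c => Some (a c)).
Proof.
move=> ca; have: computable (fun c => [:: a c]) by computability.
by case=> g rg ga; exists g.
Qed.

Lemma computable_inl (a : C -> T) :
  computable a -> computable (fun c => inl (a c) : T + U).
Proof.
move=> ca; have: computable (fun c => ([:: a c], [::] : seq U)) by computability.
by case=> g rg ga; exists g.
Qed.

Lemma computable_inr (a : C -> U) :
  computable a -> computable (fun c => inr (a c) : T + U).
Proof.
move=> ca; have: computable (fun c => ([::] : seq T, [:: a c])) by computability.
by case=> g rg ga; exists g.
Qed.

End Options.

Ltac computability_option_step :=
  match goal with
  | |- computable (fun c => Some _) => apply: computable_Some
  | |- computable (fun c => inl _) => apply: computable_inl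
  | |- computable (fun c => inr _) => apply: computable_inr
  | |- computable (fun c => match _ with None => _ | Some _ => _ end) =>
    apply: computable_option_case
  end.
Ltac computability ::=
  repeat (cbv beta; first [computability_list_step | computability_step
                          | computability_option_step]).

(** A function on a finite type is a table, hence a nested conditional on codes whatever its
    definition is. *)
Lemma computable_fun_fin (C : countType) (T : finType) (U : countType)
    (f : T -> U) (a : C -> T) : computable a -> computable (fun c => f (a c)).
Proof.
move=> ca; apply: (computable_comp _ ca); move=> {C a ca}.
pose g m := foldr (fun x r => if m == pickle x then pickle (f x) else r) 0.
apply: (@computableI _ _ _ (fun m => g m (enum T))).
  rewrite /g; elim: (enum T) => [|x s IHs] /=; first exact: recursive1_const.
  move=> k h rh; have r := recursive2_eqn rh (recursive_const _ (pickle x)).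
  apply: rec_ext (recursive3_if r (recursive_const _ (pickle (f x))) (IHs _ _ rh)) _.
  by move=> v; case: eqP.
move=> x; have := mem_enum T x; rewrite /g inE.
elim: (enum T) => //= y s IHs; rewrite inE.
case: (eqVneq (pickle x) (pickle y)) => [e _|ne]; last first.
  by case: (x =P y) ne => [->|_ _ /IHs //]; rewrite eqxx.
by rewrite (pcan_inj (@pickleK T) e).
Qed.

(* Minimization is only available for functions that are regular on all of nat,
   including the numbers that are not codes, so that codes must be recognized. *)
Definition decodable (T : countType) :=
  exists2 d : nat -> seq T, computable d & forall x, d (pickle x) = [:: x].

Lemma decodable_fin (T : finType) : decodable T.
Proof.
exists (fun y => [seq x <- enum T | pickle x == y]); first by computability.
move=> x; rewrite (eq_filter (a2 := pred1 x)).
  by rewrite filter_pred1_uniq ?enum_uniq ?mem_enum.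
by move=> y; rewrite /= (inj_eq (pcan_inj pickleK)).
Qed.

Lemma computable_decode (C : countType) (a : C -> nat) :
  computable a -> computable (fun c => CodeSeq.decode (a c)).
Proof.
apply: (computable_same_code (f := CodeSeq.decode)) => x.
by rewrite -[in RHS](CodeSeq.decodeK x) [LHS]/(CodeSeq.code (map id _)) map_id.
Qed.

Lemma decodable_seq (T : countType) : decodable T -> decodable (seq T).
Proof.
case=> d cd dK; exists (fun y => [:: flatten (map d (CodeSeq.decode y))]).
  computability; first exact: computable_decode (computable_id _).
move=> s; rewrite [pickle s]/(CodeSeq.code _) CodeSeq.codeK -map_comp.
by congr [:: _]; elim: s => //= x s ->; rewrite dK.
Qed.

Lemma decodable_prod (T U : countType) :
  decodable T -> decodable U -> decodable (T * U)%type.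
Proof.
case=> d cd dK [e ce eK].
exists (fun y => [seq (p, q) | p <- d (nth 0 (CodeSeq.decode y) 0),
                               q <- e (nth 0 (CodeSeq.decode y) 1)]).
  by computability; apply: computable_decode; computability.
by case=> x y; rewrite pickle_pair CodeSeq.codeK /= dK eK.
Qed.

Lemma decodable_same_code (T U : countType) (f : U -> T) (g : T -> U) :
  computable g -> cancel f g -> (forall x, pickle (f x) = pickle x) ->
  decodable T -> decodable U.
Proof.
move=> cg fK fE [d cd dK]; exists (fun y => map g (d y)).
  computability.
by move=> x; rewrite -fE dK /= fK.
Qed.

Lemma computable_search (C T : countType) (c0 : C) (x0 : T)
    (P : C -> T -> bool) :
  decodable C -> decodable T -> computable (fun p : C * T => P p.1 p.2) ->
  (forall c, exists x, P c x) ->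
  exists2 f : C -> T, computable f & forall c, P c (f c).
Proof.
case=> d cd dK [e ce eK] cP exP.
(* Every number, code or not, is turned into an input, with [c0] as the default; so the minimization
   is regular on all of [nat]. *)
pose Q x y := has (P (head c0 (d x))) (e y).
have exQ x : exists y, Q x y.
  have [z Pz] := exP (head c0 (d x)).
  by exists (pickle z); rewrite /Q eK /= Pz.
pose m x := ex_minn (exQ x).
have cQ : computable (fun p : nat * nat => Q p.1 p.2).
  by rewrite /Q; computability.
have rm : recursive1 m.
  have [q rq qE] := computableE cQ.
  apply: (@recursive1_mu (fun y x => 1 - q (code_pair x y))).
  - move=> k g1 g2 r1 r2; apply: recursive2_subn; first exact: recursive_const.
    by apply: rq; apply: recursive2_code_pair.
  - by move=> x; rewrite (qE (x, m x)) /m; case: ex_minnP => y /= ->.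
  - move=> x y; rewrite (qE (x, y)) /m; case: ex_minnP => z _ zmin ltyz /=.
    by case: (boolP (Q x y)) => // /zmin; rewrite leqNgt ltyz.
(* The number found may decode to several candidates, only some of which satisfy [P]. *)
exists (fun c => head x0 [seq z <- e (m (pickle c)) | P c z]).
  computability.
  by apply: (computable_nat1 rm); computability.
move=> c; rewrite /m; case: ex_minnP => y; rewrite /Q dK /= => hP _.
have: head x0 [seq z <- e y | P c z] \in [seq z <- e y | P c z].
  by move: hP; rewrite has_filter; case: filter => //= z s _; apply: mem_head.
by rewrite mem_filter => /andP[].
Qed.

(** * Partial actions of the free group *)

Local Open Scope group_scope.

Section Words.
Variable n : nat.
Implicit Types (a c d : letter n) (u v w p q : seq (letter n)).

Definition fg_of w : free_group n := FreeGroup (@reduced_mul n w [::] isT).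

Lemma fg_ofK (g : free_group n) : fg_of (word g) = g.
Proof. by apply: val_inj; rewrite /= mul_word1 ?wordP. Qed.

Lemma word_fg_of w : reduced w -> word (fg_of w) = w.
Proof. exact: mul_word1. Qed.

Lemma fg_of_nil : fg_of [::] = 1.
Proof. exact: val_inj. Qed.

Lemma fg_of_cat u v : fg_of (u ++ v) = fg_of u * fg_of v.
Proof.
apply: val_inj; rewrite /= -mul_wordA ?reduced_mul //=.
by rewrite /mul_word foldr_cat.
Qed.

Lemma inv_word_cat u v : inv_word (u ++ v) = inv_word v ++ inv_word u.
Proof. by rewrite /inv_word map_cat rev_cat. Qed.

Lemma inv_word_cons a w : inv_word (a :: w) = rcons (inv_word w) (inv_letter a).
Proof. by rewrite /inv_word /= rev_cons. Qed.

Lemma inv_letter_neq a : (inv_letter a == a) = false.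
Proof. by case: a => i []; rewrite /inv_letter xpair_eqE andbC. Qed.

Lemma fg_of_inv_letter a : fg_of [:: inv_letter a] = (fg_of [:: a])^-1.
Proof.
apply: (mulIg (fg_of [:: a])); rewrite mulVg -fg_of_cat.
by apply: val_inj; rewrite /= inv_letterK eqxx.
Qed.

Lemma fg_of_inv w : fg_of (inv_word w) = (fg_of w)^-1.
Proof.
elim: w => [|a w IHw]; first by apply: val_inj.
rewrite inv_word_cons -cats1 fg_of_cat IHw fg_of_inv_letter -invgM.
by rewrite -fg_of_cat.
Qed.

Lemma reduced_catl u v : reduced (u ++ v) -> reduced u.
Proof. by rewrite /reduced; case: u => //= a u; rewrite cat_path => /andP[]. Qed.

Lemma reduced_catr u v : reduced (u ++ v) -> reduced v.
Proof. by elim: u => //= a u IHu /reduced_behead. Qed.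

End Words.

Section PartialActions.
Variable n : nat.
Implicit Types (a c d : letter n) (u v w p q : seq (letter n)).

Definition involutive_action (S : Type) (delta : letter n -> S -> option S) :=
  forall a x y, delta a x = Some y -> delta (inv_letter a) y = Some x.

Section Run.
Variables (S : Type) (delta : letter n -> S -> option S).

(* Words act from the left, hence are read from right to left. *)
Definition run w (x : S) : option S :=
  foldr (fun a ox => obind (delta a) ox) (Some x) w.

Lemma run_cat u v x : run (u ++ v) x = obind (run u) (run v x).
Proof.
rewrite /run foldr_cat; elim: u => [|a u IHu] /=; first by case: foldr.
by rewrite IHu; case: (foldr _ (Some x) v).
Qed.

Lemma run_rcons w a x : run (rcons w a) x = obind (run w) (delta a x).
Proof. by rewrite -cats1 run_cat. Qed.

Hypothesis deltaV : involutive_action delta.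

Lemma run_inv w x y : run w x = Some y -> run (inv_word w) y = Some x.
Proof.
elim: w y => [|a w IHw] y /=; first by case=> ->.
case E: (run w x) => [z|] //= dz.
by rewrite inv_word_cons run_rcons (deltaV dz) /= IHw.
Qed.

Lemma run_inj w x y z : run w x = Some z -> run w y = Some z -> x = y.
Proof. by move=> /run_inv h /run_inv; rewrite h => -[]. Qed.

(** Cancelling a letter against its inverse removes a step back along the same edge, so free
    reduction keeps the end point. The reduced word may be readable where the original one is
    not. *)
Lemma run_mul u v x y z :
  run v x = Some y -> run u y = Some z -> run (mul_word u v) x = Some z.
Proof.
move=> vx; elim: u z => [|a u IHu] z /=; first by case=> <-.
case E: (run u y) => [t|] //= dt; move/IHu: E.
case: (mul_word u v) => [|c w] //=; first by case=> ->.
case: eqP => [->|_] /= E; last by rewrite E.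
by move: E; case: (run w x) => [s|] //= /deltaV; rewrite inv_letterK dt.
Qed.

Lemma run_fg_of w x y : run w x = Some y -> run (word (fg_of w)) x = Some y.
Proof. exact: run_mul. Qed.

Definition stabilizer (x : S) (g : free_group n) := run (word g) x = Some x.

Lemma stabilizer_subgroup x : is_subgroup (stabilizer x).
Proof.
split=> // [g h gx hx|g]; first exact: run_mul hx gx.
by rewrite /stabilizer => /run_inv.
Qed.

Lemma maximal_readable_suffix w (x : S) : exists v q y,
  [/\ w = v ++ q, run q x = Some y
    & forall v' d, v = rcons v' d -> delta d y = None].
Proof.
elim: w => [|a w [v [q [y [-> qx stuck]]]]].
  by exists [::], [::], x; split=> // -[].
case: v stuck => [_|c v stuck].
  case E: (delta a y) => [z|].
    by exists [::], (a :: q), z; split=> //= [|[]//]; rewrite qx.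
  exists [:: a], q, y; split=> // -[|? []] // d [<-] //.
exists (a :: c :: v), q, y; split=> // -[|? v'] // d [_ e]; exact: stuck e.
Qed.

End Run.

Definition extends (S S' : Type) (i : S -> S')
    (delta : letter n -> S -> option S) (delta' : letter n -> S' -> option S') :=
  forall a x y, delta a x = Some y -> delta' a (i x) = Some (i y).

Lemma run_extends (S S' : Type) (i : S -> S') delta delta' :
  extends i delta delta' ->
  forall w x y, run delta w x = Some y -> run delta' w (i x) = Some (i y).
Proof.
move=> ext w x; elim: w => [|a w IHw] y /=; first by case=> ->.
by case E: (run delta w x) => [z|] //= /ext; rewrite (IHw z E).
Qed.

Section AddEdge.
Variables (S : eqType) (delta : letter n -> S -> option S).
Variables (c : letter n) (x y : S).

Definition add_edge a s :=
  if (a == c) && (s == x) then Some y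
  else if (a == inv_letter c) && (s == y) then Some x else delta a s.

Lemma add_edgeE : add_edge c x = Some y.
Proof. by rewrite /add_edge !eqxx. Qed.

Hypothesis deltaV : involutive_action delta.
Hypotheses (cx : delta c x = None) (cy : delta (inv_letter c) y = None).

Lemma add_edge_extends : extends id delta add_edge.
Proof.
move=> a s t ast; rewrite /add_edge.
case: ifP => [/andP[/eqP e1 /eqP e2]|_]; first by move: ast; rewrite e1 e2 cx.
by case: ifP => [/andP[/eqP e1 /eqP e2]|_] //; move: ast; rewrite e1 e2 cy.
Qed.

Lemma add_edge_involutive : involutive_action add_edge.
Proof.
move=> a s t; rewrite {1}/add_edge.
case: ifP => [/andP[/eqP-> /eqP->] [<-]|_].
  by rewrite /add_edge inv_letter_neq !eqxx.
case: ifP => [/andP[/eqP-> /eqP->] [<-]|_ /deltaV/add_edge_extends //].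
by rewrite inv_letterK add_edgeE.
Qed.

End AddEdge.

(** The inner [None] is the new, still isolated vertex; the outer one means that the letter cannot
    be read. *)
Definition add_vertex (S : Type) (delta : letter n -> S -> option S) a
    (s : option S) : option (option S) :=
  omap Some (obind (delta a) s).

Lemma add_vertex_involutive (S : Type) (delta : letter n -> S -> option S) :
  involutive_action delta -> involutive_action (add_vertex delta).
Proof.
move=> dV a [s|] y //=; rewrite /add_vertex /=.
by case E: (delta a s) => [t|] //= [<-] /=; rewrite (dV _ _ _ E).
Qed.

(* If v cannot be read at either end, then an arc labelled v is attached by
   adding its edges one by one. When x = y and the first letter of v is the
   inverse of the last one, the new edge is shared by both ends. *)
Lemma attach_arc v (S : eqType) (delta : letter n -> S -> option S) x y :
  involutive_action delta -> v != [::] -> reduced v ->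
  (forall v' d, v = rcons v' d -> delta d x = None) ->
  (forall v' c, v = c :: v' -> delta (inv_letter c) y = None) ->
  exists (S' : eqType) (i : S -> S') (delta' : letter n -> S' -> option S'),
  [/\ involutive_action delta', injective i, extends i delta delta'
    & run delta' v (i x) = Some (i y)].
Proof.
(* The type of states is generalized too, because each recursive call works on a type with one more
   vertex. *)
have [m] := ubnP (size v); elim: m => // m IHm in v S delta x y * => le_vm dV.
case/lastP: v le_vm => // v d; rewrite size_rcons ltnS => le_vm _ rv lst fst.
have dx := lst _ _ erefl.
case: v le_vm rv fst {lst} => [|c v] le_vm rv fst.
  have dy := fst [::] d erefl.
  exists S, id, (add_edge delta d x y); split=> //.
  - exact: add_edge_involutive.
  - exact: add_edge_extends.
  - by rewrite /= add_edgeE.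
have cy := fst _ _ erefl.
(* The last letter is read first: it now leads from [x] to the new vertex, from which the rest of
   the word has to lead to [y]. *)
pose delta1 := add_edge (add_vertex delta) d (Some x) None.
have dx1 : add_vertex delta d (Some x) = None by rewrite /add_vertex /= dx.
have d1V : involutive_action delta1.
  by apply: add_edge_involutive => //; apply: add_vertex_involutive.
have ext1 : extends Some delta delta1.
  move=> a s t ast; apply: add_edge_extends => //.
  by rewrite /add_vertex /= ast.
have d1None a : a != inv_letter d -> delta1 a None = None.
  by move=> ne; rewrite /delta1 /add_edge andbF (negPf ne).
have lastP w e : reduced (rcons (rcons w e) d) -> delta1 e None = None.
  rewrite /reduced -!cats1 -catA => /reduced_catr /=; rewrite andbT => ne.
  by apply: d1None; apply: contraNneq ne => ->; rewrite inv_letterK.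
case E : (delta1 (inv_letter c) (Some y)) => [t|].
  have [ec ey et] : [/\ inv_letter c = d, y = x & t = None].
    move: E; rewrite /delta1 /add_edge.
    case: ifP => [/andP[/eqP-> /eqP[->]] [<-] //|_].
    by rewrite andbF /add_vertex /= cy.
  case: v le_vm rv fst => [|e v] le_vm rv _.
    by move: rv; rewrite /reduced /= ec eqxx.
  (* The shared edge serves both the first and the last letter. What lies between them becomes a
     loop at the new vertex; it is nonempty, since two inverse letters cannot be adjacent in a
     reduced word. *)
  have [||||S' [i [delta' [d'V injj ext' run']]]] :=
      IHm (e :: v) _ delta1 None None _ d1V isT.
  - exact: ltnW le_vm.
  - by apply: (@reduced_catl _ _ [:: d]); rewrite cats1; exact: reduced_behead rv.
  - move=> v' f ev; apply: (@lastP v' f); rewrite -ev.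
    exact: reduced_behead rv.
  - move=> v' f [<- _]; apply: d1None; rewrite -ec.
    apply: contraTneq rv => /(inv_inj (@inv_letterK n)) ->.
    by rewrite /reduced /= eqxx.
  exists S', (fun s => i (Some s)), delta'; split=> //.
  - by move=> s t' /injj[].
  - by move=> a s t' /ext1/ext'.
  have := add_edgeE (add_vertex delta) d (Some x) None.
  move=> edge; have := ext' _ _ _ edge => e1.
  rewrite run_rcons e1 [obind _ _]/(obind (delta' c) (run delta' (e :: v) _)).
  rewrite run' /= ey.
  by move: (d'V _ _ _ e1); rewrite -ec inv_letterK.
have [||||S' [i [delta' [d'V injj ext' run']]]] :=
      IHm (c :: v) _ delta1 None (Some y) _ d1V isT.
- exact: le_vm.
- by apply: (@reduced_catl _ _ [:: d]); rewrite cats1.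
- by move=> v' f ev; apply: (@lastP v' f); rewrite -ev.
- by move=> v' f [<- _].
exists S', (fun s => i (Some s)), delta'; split=> //.
- by move=> s t' /injj[].
- by move=> a s t' /ext1/ext'.
have := add_edgeE (add_vertex delta) d (Some x) None => edge.
by rewrite run_rcons (ext' _ _ _ edge).
Qed.

End PartialActions.

(** * Cocycles and cyclic reduction *)

Section Generation.
Variable G : groupType.
Implicit Types (H X : G -> Prop) (u g : G).

Lemma generated_subgroup X : is_subgroup (generated X).
Proof.
split=> [K sK _|x y gx gy K sK XK|x gx K sK XK]; first exact: subgroup1 sK.
  by apply: (subgroupM sK); [exact: gx | exact: gy].
by apply: (subgroupV sK); exact: gx.
Qed.

Lemma generated_incl X g : X g -> generated X g.
Proof. by move=> Xg K _; apply. Qed.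

Lemma generated_sub X Y :
  (forall g, X g -> generated Y g) -> forall g, generated X g -> generated Y g.
Proof. by move=> XY g; apply=> //; apply: generated_subgroup. Qed.

Definition spans H u := forall g, generated (fun x => H x \/ x = u) g.

Lemma spans_double_coset H u v h h' : is_subgroup H -> H h -> H h' ->
  u = h * v * h' -> spans H u <-> spans H v.
Proof.
have half w w' k k' : is_subgroup H -> H k -> H k' ->
    w = k * w' * k' -> spans H w -> spans H w'.
  move=> sH Hk Hk' e sw g; apply: generated_sub (sw g) => x.
  have sK := generated_subgroup (fun x => H x \/ x = w').
  case=> [Hx|->]; first by apply: generated_incl; left.
  rewrite e; apply: (subgroupM sK); last by apply: generated_incl; left.
  by apply: (subgroupM sK); apply: generated_incl; [left | right].
move=> sH Hh Hh' e; split; first exact: half e.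
apply: (half v u h^-1 h'^-1) => //; try exact: subgroupV.
by rewrite e -!mulgA mulgV mulg1 mulKg.
Qed.

(** Elements of a cyclic group are quotients of natural powers; this form does without integer
    exponents. *)
Lemma generated1P u g : generated (fun x => x = u) g ->
  exists i j, g * u ^+ j = u ^+ i.
Proof.
move=> gu; apply: (gu (fun g => exists i j, g * u ^+ j = u ^+ i)); last first.
  by move=> _ ->; exists 1%N, 0%N; rewrite expg0 mulg1 expg1.
split.
- by exists 0%N, 0%N; rewrite mulg1.
- move=> x y [i [j xj]] [k [l yl]]; exists (i + k)%N, (l + j)%N.
  rewrite expgnDr mulgA -(mulgA x) yl -mulgA -expgnDr addnC expgnDr mulgA xj.
  by rewrite expgnDr.
- by move=> x [i [j xj]]; exists j, i; rewrite -xj mulKg.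
Qed.

(** As H is closed under inverses, positive powers suffice. The conclusion is [u ^+ k.+1 = 1]
    instead of a contradiction because u = 1 is allowed, and occurs when H is the whole group. *)
Lemma trivial_meet_cyclic H u : is_subgroup H ->
  (forall g, H g /\ generated (fun x => x = u) g <-> g = 1) <->
  (forall k, H (u ^+ k.+1) -> u ^+ k.+1 = 1).
Proof.
move=> sH; have su := generated_subgroup (fun x => x = u).
split=> [hu k Hk|hu g]; last split=> [[Hg /generated1P[i [j gj]]]|->].
- apply/hu; split=> //; elim: k {Hk} => [|k IHk].
    by rewrite expg1; apply: generated_incl.
  by rewrite expgS; apply: (subgroupM su) => //; apply: generated_incl.
- have [le_ij|lt_ji] := leqP i j.
    have gV : g^-1 = u ^+ (j - i) by rewrite expgnFr // -gj invgM mulgA mulgV mul1g.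
    have HgV := subgroupV sH Hg; apply: invg_inj; rewrite invg1.
    by case: (j - i)%N gV HgV => [|k] -> //; exact: hu.
  have gE : g = u ^+ (i - j) by rewrite expgnFr 1?ltnW // -gj mulgK.
  by case: (i - j)%N gE Hg => [|k] -> //; exact: hu.
- by split; [exact: subgroup1 sH | exact: subgroup1 su].
Qed.

End Generation.

(** * Reducedness of concatenations and cyclic reduction *)

Section Kinds.
Variable n : nat.
Implicit Types (a c d : letter n) (u v w : seq (letter n)).

Local Notation kind := (bool * option (letter n) * option (letter n))%type.

(** A finite invariant that determines whether a product is reduced: apart from the factors, only
    the letters that meet matter. [kmul] and [kinv] are the operations it induces. *)
Definition kind_of w : kind := (reduced w, ohead w, ohead (rev w)).

Definition kmul (k k' : kind) : kind :=
  let: (r, f, l) := k in let: (r', f', l') := k' in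
  ([&& r, r' & if l is Some d then if f' is Some c then c != inv_letter d
                                   else true else true],
   if f is Some _ then f else f', if l' is Some _ then l' else l).

Definition kinv (k : kind) : kind :=
  let: (r, f, l) := k in (r, omap (@inv_letter n) l, omap (@inv_letter n) f).

Lemma kind_of_cat u v : kind_of (u ++ v) = kmul (kind_of u) (kind_of v).
Proof.
rewrite /kind_of rev_cat /=.
have ->: ohead (u ++ v) = if ohead u is Some _ then ohead u else ohead v.
  by case: u.
have ->: ohead (rev v ++ rev u) =
    if ohead (rev v) is Some _ then ohead (rev v) else ohead (rev u).
  by case: (rev v).
congr (_, _, _).
case/lastP: u => [|u d] /=; first by rewrite andbT.
rewrite rev_rcons /=; case: v => [|c v] /=; first by rewrite cats0 !andbT.
rewrite /reduced; case: u => [|e u] /=; first by rewrite andbC.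
by rewrite cat_path last_rcons /= [_ && path _ c v]andbC.
Qed.

Lemma kind_of_inv w : kind_of (inv_word w) = kinv (kind_of w).
Proof.
have h (f : letter n -> letter n) s : ohead (map f s) = omap f (ohead s).
  by case: s.
rewrite /kind_of /kinv {2}/inv_word -map_rev h {2}/inv_word revK h.
congr (_, _, _); apply/idP/idP; last exact: reduced_inv.
by move/reduced_inv; rewrite inv_wordK.
Qed.

(** [reduced (w ++ w)] expresses that w is cyclically reduced and also holds for the empty word.
    Inverse end letters are stripped until none are left. *)
Lemma cyclic_reduction u : reduced u ->
  exists s w, u = inv_word s ++ w ++ s /\ reduced (w ++ w).
Proof.
have [m] := ubnP (size u); elim: m => // m IHm in u *.
case: u => [|c u] le_um ru; first by exists [::], [::].
case/lastP: u le_um ru => [|u d] le_um ru.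
  by exists [::], [:: c]; rewrite /reduced /= eq_sym inv_letter_neq.
have [ec|ne] := eqVneq c (inv_letter d); last first.
  exists [::], (c :: rcons u d); rewrite cats0; split=> //.
  have ku : kind_of (c :: rcons u d) = (true, Some c, Some d).
    by rewrite /kind_of ru -rcons_cons rev_rcons.
  rewrite -[reduced _]/(kind_of (_ ++ _)).1.1 kind_of_cat ku /=.
  exact: ne.
have [||s [w [eu rw]]] := IHm u.
- by move: le_um; rewrite /= size_rcons ltnS => /ltnW.
- by apply: (@reduced_catl _ _ [:: d]); rewrite cats1; exact: reduced_behead ru.
exists (rcons s d), w; split=> //.
rewrite eu /inv_word map_rcons rev_rcons /= ec -!cats1.
by rewrite !catA.
Qed.

End Kinds.

(** * Splitting of spanning elements *)

Section Split.
Variable n : nat.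
Implicit Types (a c d : letter n) (u v w p q : seq (letter n)).

Lemma run_letters (S : Type) (delta : letter n -> S -> option S) (o : S) :
  (forall a, delta a o = Some o) -> forall w, run delta w o = Some o.
Proof.
by move=> loops; elim=> //= a w; rewrite -/(run delta w o) => -> /=.
Qed.

Lemma spanning_split (S : eqType) (delta : letter n -> S -> option S) (o : S)
    (H : free_group n -> Prop) (u : free_group n) :
  involutive_action delta -> (forall a, delta a o) ->
  (forall h, H h -> stabilizer delta o h) -> spans H u ->
  exists p q x y, [/\ word u = p ++ q, run delta q o = Some x
                    & run delta (inv_word p) o = Some y].
Proof.
move=> dV hair HK sp.
(* The word is read from its right end as far as possible, and then the inverse of what remains; [v]
   below is stuck at both ends. *)
have [v0 [q [x [eu qx stuckx]]]] := maximal_readable_suffix delta (word u) o.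
have [v1 [p [y [ep py stucky]]]] := maximal_readable_suffix delta (inv_word v0) o.
have {}ep : v0 = inv_word p ++ inv_word v1.
  by rewrite -inv_word_cat -ep inv_wordK.
have [v1nil|nv1] := eqVneq v1 [::].
  exists (inv_word p), q, x, y; split=> //; last by rewrite inv_wordK.
  by rewrite eu ep v1nil cats0.
exfalso; set v := inv_word v1 in ep.
have nv : v != [::].
  by apply: contraNneq nv1 => e; rewrite -[v1]inv_wordK -/v e.
have rv : reduced v.
  have := wordP u; rewrite eu => /reduced_catl; rewrite ep; exact: reduced_catr.
have vlst v' d : v = rcons v' d -> delta d x = None.
  by move=> e; apply: (stuckx (inv_word p ++ v')); rewrite ep e rcons_cat.
have vfst v' c : v = c :: v' -> delta (inv_letter c) y = None.
  move=> e; apply: (stucky (inv_word v')).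
  by rewrite -[v1]inv_wordK -/v e inv_word_cons.
have [S' [i [delta' [d'V injj ext run']]]] := attach_arc dV nv rv vlst vfst.
(* H and u both fix the base point of the extended action, so the group that they span does. *)
have stab' g : stabilizer delta' (i o) g.
  apply: (sp g _ (stabilizer_subgroup d'V (i o))) => h [/HK Kh|->].
    exact: run_extends ext _ _ _ Kh.
  rewrite /stabilizer eu ep -catA !run_cat.
  rewrite (run_extends ext qx) /= run' /=.
  by apply: (run_inv d'V); apply: run_extends ext _ _ _ py.
(* The edge labelled [a] at [o] exists already in [delta]; it is a loop in the extension and, as [i]
   is injective, in [delta]. Then [q] ends at [o], where no letter is stuck. *)
have loops a : delta a o = Some o.
  case E: (delta a o) (hair a) => [t|] // _.
  have := stab' (fg_of [:: a]); rewrite /stabilizer /= (ext _ _ _ E) => -[].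
  by move/injj->.
have [v' [d ev]] : exists v' d, v = rcons v' d.
  by case/lastP: (v) nv => // v' d; exists v', d.
have := vlst _ _ ev.
by move: qx; rewrite (run_letters loops) => -[<-]; rewrite loops.
Qed.

Lemma cat_eq_cat (T : Type) (u1 u2 p q : seq T) : u1 ++ u2 = p ++ q ->
  (exists2 t, u1 = p ++ t & q = t ++ u2) \/
  (exists2 t, p = u1 ++ t & u2 = t ++ q).
Proof.
elim: u1 p => [|a u1 IHu] [|c p] /= e.
- by left; exists [::].
- by right; exists (c :: p).
- by left; exists (a :: u1).
case: e => -> /IHu[[t -> ->]|[t -> ->]]; first by left; exists t.
by right; exists t.
Qed.

(* A splitting of s^-1 w s can always be moved into w: s is read both from the
   right and, inverted, from the left. *)
Lemma conjugate_split (S : Type) (delta : letter n -> S -> option S) (o : S)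
    p q s w x y :
  involutive_action delta ->
  inv_word s ++ w ++ s = p ++ q -> run delta q o = Some x ->
  run delta (inv_word p) o = Some y ->
  exists w1 w2 z r t, [/\ w = w1 ++ w2, run delta s o = Some z,
    run delta w2 z = Some r & run delta w1 t = Some z].
Proof.
move=> dV e qx py.
have suffixE t t' (r : S) : run delta (t ++ t') o = Some r ->
    exists2 r', run delta t' o = Some r' & run delta t r' = Some r.
  by rewrite run_cat; case: (run delta t' o) => // r'; exists r'.
(* The cut lies in s^-1, in w or in s. In the outer cases one side reads both s and the whole of w,
   or its inverse, so [w1] or [w2] may be taken empty. *)
have [[t _ eq]|[t ep /cat_eq_cat[[t' ew eq]|[t' et _]]]] := cat_eq_cat e.
- move: qx; rewrite eq => /suffixE[r /suffixE[z sz wz] _].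
  by exists [::], w, z, r, z.
- move: qx; rewrite eq => /suffixE[z sz t'z].
  move: py; rewrite ep inv_word_cat inv_wordK => /suffixE[z'].
  rewrite sz => -[<-] tz; exists t, t', z, x, y; split=> //.
  by move/(run_inv dV): tz; rewrite inv_wordK.
move: py; rewrite ep et !inv_word_cat inv_wordK -catA => /suffixE[r].
move=> /suffixE[z sz wz] _; exists w, [::], z, z, r; rewrite cats0; split=> //.
by move/(run_inv dV): wz; rewrite inv_wordK.
Qed.

End Split.

(** * Periodic points of the partial injection induced by a word *)

Section Periodicity.
Variables (n : nat) (S : eqType) (delta : letter n -> S -> option S).
Variable Q : seq S.
Hypothesis deltaV : involutive_action delta.
Hypothesis deltaQ : forall a x y, delta a x = Some y -> y \in Q.

Lemma run_target w x y : x \in Q -> run delta w x = Some y -> y \in Q.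
Proof.
case: w => [|a w] xQ; first by case=> <-.
by rewrite /run /=; case: (foldr _ _ w) => //= z /deltaQ.
Qed.

Definition iter_run w k (x : option S) := iter k (obind (run delta w)) x.

Lemma iter_run_None w k : iter_run w k None = None.
Proof. by elim: k => //= k; rewrite -/(iter_run _ _ _) => ->. Qed.

Lemma iter_runD w k m x : iter_run w (k + m) x = iter_run w k (iter_run w m x).
Proof. exact: iterD. Qed.

Lemma run_power w k x : run delta (flatten (nseq k w)) x = iter_run w k (Some x).
Proof. by elim: k => //= k IHk; rewrite run_cat IHk. Qed.

Lemma run_conjugate_power s w k o x : run delta s o = Some x ->
  run delta (inv_word s ++ flatten (nseq k w) ++ s) o =
  obind (run delta (inv_word s)) (iter_run w k (Some x)).
Proof. by move=> sx; rewrite -run_power !run_cat sx. Qed.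

Lemma iter_run_cancel w i k x y :
  iter_run w (i + k) (Some x) = Some y -> iter_run w i (Some x) = Some y ->
  iter_run w k (Some x) = Some x.
Proof.
elim: i y => [|i IHi] y; first by move=> h1 h2; rewrite h1.
rewrite addSn /iter_run !iterS -!/(iter_run _ _ _).
case E1: (iter_run w (i + k) _) => [z|] //= wz.
case E2: (iter_run w i _) => [z'|] //= wz'.
by apply: (IHi z) => //; rewrite E2 (run_inj deltaV wz wz').
Qed.

(* The orbit of x either stays in Q forever, and is then periodic because w acts
   injectively, or it leaves Q within size Q steps. *)
Lemma iter_run_periodic w x : x \in Q ->
  (iter_run w (size Q) (Some x) = None) <->
  (forall k, iter_run w k.+1 (Some x) <> Some x).
Proof.
move=> xQ; split=> [out k per|np].
  have perm m : iter_run w (m * k.+1) (Some x) = Some x.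
    by elim: m => // m IHm; rewrite mulSn iter_runD IHm.
  have := perm (size Q); rewrite mulnS addnC iter_runD out.
  by rewrite iter_run_None.
case E: (iter_run w (size Q) (Some x)) => [y|] //; exfalso.
pose it i := iter_run w i (Some x).
have inQ i : i <= size Q -> it i \in map Some Q.
  move=> leiQ; have : it i != None.
    apply: contra_eqN E => /eqP e.
    by rewrite -(subnK leiQ) iter_runD -/(it i) e iter_run_None.
  rewrite /it; elim: i {leiQ} => [|i IHi] /=; first by rewrite map_f.
  case F: (iter_run w i _) IHi => [z|] //= IHi; case G: (run _ _ _) => [t|] // _.
  apply: map_f; apply: run_target G.
  by have /mapP[z' z'Q [->]] := IHi isT.
(* Pigeonhole: size Q + 1 iterates lie in a list of length size Q. Injectivity turns the coincidence
   of two of them into a return to [x]. *)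
have : ~~ uniq (mkseq it (size Q).+1).
  have sub : {subset mkseq it (size Q).+1 <= map Some Q}.
    by move=> z /mapP[i]; rewrite mem_iota ltnS => /inQ ? ->.
  apply/negP => /uniq_leq_size/(_ sub).
  by rewrite size_mkseq size_map ltnn.
case/(uniqPn None) => i [j [ltij]]; rewrite size_mkseq => ltj.
rewrite !nth_mkseq //; last exact: ltn_trans ltj.
have /mapP[z _ ez] := inQ i (leq_trans (ltnW ltij) ltj).
rewrite ez -(subnKC (ltnW ltij)) => /esym/iter_run_cancel/(_ ez).
by rewrite -[(j - i)%N]prednK ?subn_gt0 //; apply: np.
Qed.

End Periodicity.

(** * Cocycles in terms of a coset action *)

Section Characterization.
Variables (n : nat) (H : free_group n -> Prop).
Variable delta : letter n -> free_group n -> option (free_group n).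
Variable Q : seq (free_group n).

(* States are representatives x of left cosets x H. *)
Record coset_action : Prop := CosetAction {
  coset_actionV : involutive_action delta;
  coset_action_sound : forall a x y, delta a x = Some y ->
    H (y^-1 * (fg_of [:: a] * x));
  coset_action_complete : forall h, H h -> stabilizer delta 1 h;
  coset_action_hair : forall a, delta a 1;
  coset_action_base : 1 \in Q;
  coset_action_states : forall a x y, delta a x = Some y -> y \in Q }.

Hypotheses (sH : is_subgroup H) (act : coset_action).

Lemma run_sound w x y : run delta w x = Some y -> H (y^-1 * (fg_of w * x)).
Proof.
elim: w y => [|a w IHw] y /=.
  by case=> <-; rewrite fg_of_nil mul1g mulVg; apply: subgroup1.
rewrite -/(run delta w x); case E: (run delta w x) => [z|] //= dz.
have := subgroupM sH (coset_action_sound act dz) (IHw z E).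
by rewrite -(cat1s a w) fg_of_cat -!mulgA mulVKg.
Qed.

Lemma stabilizerE g : stabilizer delta 1 g <-> H g.
Proof.
split; last exact: coset_action_complete act g.
by move=> /run_sound; rewrite fg_ofK invg1 mul1g mulg1.
Qed.

Lemma power_conjugate (s w : seq (letter n)) k :
  (@fg_of n (inv_word s ++ w ++ s)) ^+ k =
  fg_of (inv_word s ++ flatten (nseq k w) ++ s).
Proof.
rewrite !fg_of_cat fg_of_inv mulgA; elim: k => [|k IHk].
  by rewrite /= fg_of_nil expg0 mul1g mulVg.
by rewrite expgS IHk /= fg_of_cat !mulgA mulgK.
Qed.

(** Consecutive copies of w meet without cancellation, and the end letters stay the same. So s^-1 w
    s and s^-1 w^(k+1) s are reduced together. *)
Lemma kind_of_power (w : seq (letter n)) k : reduced (w ++ w) ->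
  kind_of (flatten (nseq k.+1 w)) = kind_of w.
Proof.
move=> rw; elim: k => [|k IHk]; first by rewrite /= cats0.
rewrite [flatten _]/(w ++ flatten (nseq k.+1 w)) kind_of_cat IHk -kind_of_cat.
rewrite /kind_of rw (reduced_catl rw) rev_cat.
by case: w {rw IHk} => //= a w; rewrite rev_cons; case: (rev w).
Qed.

Lemma reduced_power_conjugate (s w : seq (letter n)) k :
  reduced (inv_word s ++ w ++ s) -> reduced (w ++ w) ->
  reduced (inv_word s ++ flatten (nseq k.+1 w) ++ s).
Proof.
move=> ru rw; rewrite -[reduced _]/(kind_of _).1.1.
by rewrite kind_of_cat (kind_of_cat (flatten _)) kind_of_power // -!kind_of_cat.
Qed.

(** For fixed Q, each condition depends only on the kinds of s, w1, w2 and on their actions on Q,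
    which a grammar can remember. The alternative [w1 ++ w2 = [::]] admits u = 1, for which every
    state is periodic. *)
Theorem oplus_cocycleP (u : free_group n) : oplus_cocycle H u <->
  exists s w1 w2 x a b,
  [/\ word u = inv_word s ++ (w1 ++ w2) ++ s /\ reduced ((w1 ++ w2) ++ w1 ++ w2),
      [/\ run delta s 1 = Some x, run delta w2 x = Some a & run delta w1 b = Some x],
      [/\ a \in Q, b \in Q & spans H (b^-1 * a)]
    & w1 ++ w2 = [::] \/ iter_run delta (w1 ++ w2) (size Q) (Some x) = None].
Proof.
have dV := coset_actionV act.
(* The runs give x^-1 s, a^-1 w2 x and x^-1 w1 b in H, and u is the product of s^-1 x, x^-1 w1 b,
   b^-1 a, a^-1 w2 x and x^-1 s. *)
have key s w1 w2 x a b : word u = inv_word s ++ (w1 ++ w2) ++ s ->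
    run delta s 1 = Some x -> run delta w2 x = Some a ->
    run delta w1 b = Some x -> spans H u <-> spans H (b^-1 * a).
  move=> eu /run_sound; rewrite mulg1 => sx /run_sound w2x /run_sound w1b.
  have Hh := subgroupM sH (subgroupV sH sx) w1b.
  apply: (spans_double_coset sH Hh (subgroupM sH w2x sx)).
  rewrite -[u]fg_ofK eu !fg_of_cat fg_of_inv invgM invgK.
  by rewrite -!mulgA !mulVKg.
split=> [[sp /(trivial_meet_cyclic _ sH) meet]|].
  have [s [w [eu rw]]] := cyclic_reduction (wordP u).
  have [p [q [x' [y' [eu' qx' py']]]]] :=
    spanning_split dV (coset_action_hair act) (coset_action_complete act) sp.
  have [w1 [w2 [x [a [b [ew sx w2x w1b]]]]]] :=
    conjugate_split dV (etrans (esym eu) eu') qx' py'.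
  have xQ := run_target (coset_action_states act) (coset_action_base act) sx.
  exists s, w1, w2, x, a, b; rewrite -ew.
  split; [by [] | by [] | split | ].
  - exact: (run_target (coset_action_states act) xQ w2x).
  - exact: (run_target (coset_action_states act) xQ (run_inv dV w1b)).
  - by apply/(key s w1 w2 x a b) => //; rewrite -ew.
  have [->|nw] := eqVneq w [::]; [by left | right].
  apply/(iter_run_periodic dV (coset_action_states act) _ xQ) => k per.
  have ru : reduced (inv_word s ++ w ++ s) by rewrite -eu wordP.
  have uk : u ^+ k.+1 = fg_of (inv_word s ++ flatten (nseq k.+1 w) ++ s).
    by rewrite -power_conjugate -eu fg_ofK.
  have /meet : H (u ^+ k.+1).
    apply/stabilizerE; rewrite uk; apply: run_fg_of => //.
    by rewrite (run_conjugate_power _ _ sx) per; apply: run_inv.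
  (* The word s^-1 w^(k+1) s is already reduced and contains the nonempty w, so it does not
     represent 1. *)
  rewrite uk => /(congr1 (@word n)); rewrite word_fg_of.
    by move: nw; case: (inv_word s) => //; case: (w).
  exact: reduced_power_conjugate.
case=> s [w1 [w2 [x [a [b [[eu rw] [sx w2x w1b] [aQ bQ sp] out]]]]]].
split; first exact/(key s w1 w2 x a b).
apply/(trivial_meet_cyclic _ sH) => k Hk.
have uk : u ^+ k.+1 = fg_of (inv_word s ++ flatten (nseq k.+1 (w1 ++ w2)) ++ s).
  by rewrite -power_conjugate -eu fg_ofK.
case: out => [nilw|out].
  have -> : u = 1 by rewrite -[u]fg_ofK eu nilw fg_of_cat fg_of_inv mulVg.
  by rewrite expg1n.
have xQ := run_target (coset_action_states act) (coset_action_base act) sx.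
have [] := (iter_run_periodic dV (coset_action_states act) _ xQ).1 out k.
move/stabilizerE: Hk; rewrite uk /stabilizer word_fg_of; last first.
  by apply: reduced_power_conjugate; rewrite -?eu ?wordP.
rewrite (run_conjugate_power _ _ sx).
(* Reading s^-1 from [y] ends at 1, so reading s from 1 ends at [y]. Hence y = x, and x is
   periodic. *)
case: (iter_run _ _ _ _) => [y|] //= /(run_inv dV).
by rewrite inv_wordK sx.
Qed.

End Characterization.

(** * Linear grammars reading profiles *)

Section ProfileGrammar.
Variables (n : nat) (P : countType).
Variables (U : seq P) (init : P) (step : letter n -> P -> P).
Variable acc : P -> P -> P -> bool.

(** Computed from right to left, in the direction of [run]; thus adding a letter on the left of a
    piece costs one [step]. *)
Definition profile (w : seq (letter n)) : P := foldr step init w.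

(* A nonterminal lists the profiles of the pieces of s^-1 w1 w2 s generated so
   far, the last one first: s grows outwards on both sides, then w2 and w1 grow
   to the left. *)
Definition profile_nt (l : seq P) : nat := pickle l.

Definition profile_pairs : seq (P * P) := [seq (p, q) | p <- U, q <- U].
Definition profile_triples : seq (P * P * P) :=
  [seq (pq, r) | pq <- profile_pairs, r <- U].

Definition wrap_productions : seq (nat * seq (nat + letter n)) :=
  [seq (profile_nt [:: p],
        [:: inr (inv_letter a); inl (profile_nt [:: step a p]); inr a])
     | p <- U, a <- enum {: letter n}].
Definition enter2_productions : seq (nat * seq (nat + letter n)) :=
  [seq (profile_nt [:: p], [:: inl (profile_nt [:: init; p])]) | p <- U].
Definition grow2_productions : seq (nat * seq (nat + letter n)) :=
  [seq (profile_nt [:: x.2; x.1],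
        [:: inl (profile_nt [:: step a x.2; x.1]); inr a])
     | x <- profile_pairs, a <- enum {: letter n}].
Definition enter1_productions : seq (nat * seq (nat + letter n)) :=
  [seq (profile_nt [:: x.2; x.1], [:: inl (profile_nt [:: init; x.2; x.1])])
     | x <- profile_pairs].
Definition grow1_productions : seq (nat * seq (nat + letter n)) :=
  [seq (profile_nt [:: x.2; x.1.2; x.1.1],
        [:: inl (profile_nt [:: step a x.2; x.1.2; x.1.1]); inr a])
     | x <- profile_triples, a <- enum {: letter n}].
(** Triples follow the order of generation s, w2, w1, while [acc] takes s, w1, w2. *)
Definition stop_productions : seq (nat * seq (nat + letter n)) :=
  [seq (profile_nt [:: x.2; x.1.2; x.1.1], [::])
     | x <- [seq x <- profile_triples | acc x.1.1 x.2 x.1.2]].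

Definition profile_productions :=
  wrap_productions ++ enter2_productions ++ grow2_productions ++
  enter1_productions ++ grow1_productions ++ stop_productions.

Definition profile_grammar : grammar (letter n) :=
  Grammar (profile_nt [:: init]) profile_productions.

Hypothesis initU : init \in U.
Hypothesis stepU : forall a p, p \in U -> step a p \in U.

Lemma profileU w : profile w \in U.
Proof. by elim: w => //= a w; apply: stepU. Qed.

Definition profile_language (w : seq (letter n)) := exists s w1 w2,
  w = inv_word s ++ (w1 ++ w2) ++ s /\ acc (profile s) (profile w1) (profile w2).

Lemma profile_nt_inj : injective profile_nt.
Proof. exact: (pcan_inj pickleK). Qed.

Lemma mem_profile_pairs p q :
  p \in U -> q \in U -> (p, q) \in profile_pairs.
Proof. by move=> pU qU; apply/allpairsP; exists (p, q). Qed.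

Lemma mem_profile_triples p q r :
  p \in U -> q \in U -> r \in U -> (p, q, r) \in profile_triples.
Proof.
move=> pU qU rU; apply/allpairsP; exists ((p, q), r); split=> //=.
exact: mem_profile_pairs.
Qed.

Let D := clos_refl_trans _ (derives1 profile_grammar).
Let T (w : seq (letter n)) : seq (nat + letter n) := map inr w.

Lemma derives_step X (r u v : seq (nat + letter n)) :
  (X, r) \in profile_productions -> D (u ++ inl X :: v) (u ++ r ++ v).
Proof. by move=> h; apply: rt_step; apply: Derives1. Qed.

Lemma derives_wrap s u v :
  D (u ++ inl (profile_nt [:: init]) :: v)
    (u ++ T (inv_word s) ++ inl (profile_nt [:: profile s]) :: T s ++ v).
Proof.
elim: s => [|a s IHs]; first exact: rt_refl.
apply: rt_trans IHs _.
have h : (profile_nt [:: profile s], [:: inr (inv_letter a);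
    inl (profile_nt [:: step a (profile s)]); inr a]) \in profile_productions.
  rewrite mem_cat; apply/orP; left.
  by apply/allpairsP; exists (profile s, a); rewrite profileU mem_enum.
have := derives_step (u ++ T (inv_word s)) (T s ++ v) h.
by rewrite inv_word_cons /T map_rcons -cats1 /= -!catA.
Qed.

Lemma derives_grow2 s w u v :
  D (u ++ inl (profile_nt [:: init; profile s]) :: v)
    (u ++ inl (profile_nt [:: profile w; profile s]) :: T w ++ v).
Proof.
elim: w => [|a w IHw]; first exact: rt_refl.
apply: rt_trans IHw _.
have h : (profile_nt [:: profile w; profile s],
    [:: inl (profile_nt [:: step a (profile w); profile s]); inr a])
    \in profile_productions.
  rewrite !mem_cat; apply/orP; right; apply/orP; right; apply/orP; left.
  apply/allpairsP; exists ((profile s, profile w), a); split=> //=.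
    by apply: mem_profile_pairs; apply: profileU.
  by rewrite mem_enum.
by have := derives_step u (T w ++ v) h.
Qed.

Lemma derives_grow1 s w2 w u v :
  D (u ++ inl (profile_nt [:: init; profile w2; profile s]) :: v)
    (u ++ inl (profile_nt [:: profile w; profile w2; profile s]) :: T w ++ v).
Proof.
elim: w => [|a w IHw]; first exact: rt_refl.
apply: rt_trans IHw _.
have h : (profile_nt [:: profile w; profile w2; profile s],
    [:: inl (profile_nt [:: step a (profile w); profile w2; profile s]); inr a])
    \in profile_productions.
  rewrite !mem_cat; do 4![apply/orP; right]; apply/orP; left.
  apply/allpairsP; exists ((profile s, profile w2, profile w), a); split=> //=.
    by apply: mem_profile_triples; apply: profileU.
  by rewrite mem_enum.
by have := derives_step u (T w ++ v) h.
Qed.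

Lemma profile_language_derives w : profile_language w -> language profile_grammar w.
Proof.
case=> s [w1 [w2 [-> ok]]]; rewrite /language /=.
have d1 := derives_wrap s [::] [::].
have d2 : D (T (inv_word s) ++ inl (profile_nt [:: profile s]) :: T s)
    (T (inv_word s) ++ inl (profile_nt [:: init; profile s]) :: T s).
  apply: (derives_step (r := [:: inl _])); rewrite !mem_cat.
  apply/orP; right; apply/orP; left.
  by apply/mapP; exists (profile s) => //; apply: profileU.
have d3 := derives_grow2 s w2 (T (inv_word s)) (T s).
have d4 : D (T (inv_word s) ++ inl (profile_nt [:: profile w2; profile s]) ::
             T w2 ++ T s)
    (T (inv_word s) ++ inl (profile_nt [:: init; profile w2; profile s]) ::
     T w2 ++ T s).
  apply: (derives_step (r := [:: inl _])); rewrite !mem_cat.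
  do 3![apply/orP; right]; apply/orP; left.
  apply/mapP; exists (profile s, profile w2) => //.
  by apply: mem_profile_pairs; apply: profileU.
have d5 := derives_grow1 s w2 w1 (T (inv_word s)) (T w2 ++ T s).
have d6 : D (T (inv_word s) ++
    inl (profile_nt [:: profile w1; profile w2; profile s]) ::
             T w1 ++ T w2 ++ T s)
    (T (inv_word s) ++ [::] ++ T w1 ++ T w2 ++ T s).
  apply: (derives_step (r := [::])); rewrite !mem_cat; do 5![apply/orP; right].
  apply/mapP; exists (profile s, profile w2, profile w1) => //.
  rewrite mem_filter ok /=.
  by apply: mem_profile_triples; apply: profileU.
rewrite !map_cat -!/(T _) -catA; move: d1; rewrite /= cats0 => d1.
apply: rt_trans d1 _; apply: rt_trans d2 _; apply: rt_trans d3 _.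
by apply: rt_trans d4 _; apply: rt_trans d5 _.
Qed.

(** The invariant of derivations: one disjunct for each phase and one for terminal words. The single
    nonterminal always records the profiles of the pieces around it. *)
Definition sentential_form (f : seq (nat + letter n)) :=
  (exists s, f = T (inv_word s) ++ inl (profile_nt [:: profile s]) :: T s) \/
  (exists s w2, f = T (inv_word s) ++
     inl (profile_nt [:: profile w2; profile s]) :: T (w2 ++ s)) \/
  (exists s w2 w1, f = T (inv_word s) ++
     inl (profile_nt [:: profile w1; profile w2; profile s]) ::
     T (w1 ++ w2 ++ s)) \/
  (exists2 w, f = T w & profile_language w).

Lemma unique_nonterminal p q X Y (u v : seq (nat + letter n)) :
  u ++ inl X :: v = T p ++ inl Y :: T q -> [/\ u = T p, X = Y & v = T q].
Proof.
elim: p u => [|a p IHp] [|b u] //=.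
- by case=> -> ->.
- move=> [_ e]; have: inl X \in T q by rewrite -e mem_cat inE eqxx orbT.
  by case/mapP.
- by case=> <- /IHp[-> -> ->].
Qed.

Lemma no_nonterminal w X (u v : seq (nat + letter n)) : u ++ inl X :: v <> T w.
Proof.
move=> e; have: inl X \in T w by rewrite -e mem_cat inE eqxx orbT.
by case/mapP.
Qed.

(** The nonterminals of the three phases code lists of lengths 1, 2 and 3, so injectivity of the
    coding excludes the productions of the other phases. *)
Lemma sentential_form_step f g :
  derives1 profile_grammar f g -> sentential_form f -> sentential_form g.
Proof.
case=> X r u v /=; rewrite /profile_productions !mem_cat => inP.
case=> [[s]|[[s [w2]]|[[s [w2 [w1]]]|[w]]]].
- case/unique_nonterminal => -> eX -> {u v}; move: inP; rewrite {}eX.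
  case/or4P.
  + case/allpairsP => -[p a] /= [_ _ [/profile_nt_inj[<-] ->]].
    left; exists (a :: s); rewrite inv_word_cons /T map_rcons -cats1 -!catA.
    by [].
  + case/mapP => p _ [/profile_nt_inj[<-] ->].
    by right; left; exists s, [::].
  + by case/allpairsP => -[p a] /= [_ _ [/profile_nt_inj]].
  case/or3P.
  + by case/mapP => p _ [/profile_nt_inj].
  + by case/allpairsP => -[p a] /= [_ _ [/profile_nt_inj]].
  + by case/mapP => p _ [/profile_nt_inj].
- case/unique_nonterminal => -> eX -> {u v}; move: inP; rewrite {}eX.
  case/or4P.
  + by case/allpairsP => -[p a] /= [_ _ [/profile_nt_inj]].
  + by case/mapP => p _ [/profile_nt_inj].
  + case/allpairsP => -[p a] /= [_ _ [/profile_nt_inj[<- <-] ->]].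
    by right; left; exists s, (a :: w2).
  case/or3P.
  + case/mapP => p _ [/profile_nt_inj[<- <-] ->].
    by right; right; left; exists s, w2, [::].
  + by case/allpairsP => -[p a] /= [_ _ [/profile_nt_inj]].
  + by case/mapP => p _ [/profile_nt_inj].
- case/unique_nonterminal => -> eX -> {u v}; move: inP; rewrite {}eX.
  case/or4P.
  + by case/allpairsP => -[p a] /= [_ _ [/profile_nt_inj]].
  + by case/mapP => p _ [/profile_nt_inj].
  + by case/allpairsP => -[p a] /= [_ _ [/profile_nt_inj]].
  case/or3P.
  + by case/mapP => p _ [/profile_nt_inj].
  + case/allpairsP => -[p a] /= [_ _ [/profile_nt_inj[<- <- <-] ->]].
    by right; right; left; exists s, w2, (a :: w1).
  + case/mapP => p; rewrite mem_filter => /andP[ok _].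
    case=> /profile_nt_inj[e1 e2 e3] ->; rewrite -e1 -e2 -e3 in ok.
    right; right; right; exists (inv_word s ++ (w1 ++ w2) ++ s).
      by rewrite /T !map_cat -catA.
    by exists s, w1, w2.
- by move=> /no_nonterminal.
Qed.

Theorem profile_grammarP w : language profile_grammar w <-> profile_language w.
Proof.
split; last exact: profile_language_derives.
have pres f g : D f g -> sentential_form f -> sentential_form g.
  elim=> {f g} [f g|//|f g h _ fg _ gh] ; first exact: sentential_form_step.
  by move=> /fg/gh.
move=> /pres -[|[s]|[[s [w2]]|[[s [w2 [w1]]]|[w']]]].
- by left; exists [::].
- by move=> e; case: (@no_nonterminal w (profile_nt [:: profile s]) _ _ (esym e)).
- by move=> /esym/no_nonterminal.
- by move=> /esym/no_nonterminal.
by move=> /(inj_map inr_inj) ->.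
Qed.

End ProfileGrammar.

(** * Certified coset actions *)

Section Certificates.
Variable n : nat.
Local Notation FG := (free_group n).
Local Notation edge := (FG * letter n * FG)%type.
Implicit Types (gs : seq FG) (E : seq edge).

Definition transition E (a : letter n) (x : FG) : option FG :=
  if [seq e.2 | e <- [seq e <- E | e.1 == (x, a)]] is y :: _
  then Some y else None.

Definition states E : seq FG := 1 :: [seq e.2 | e <- E].

Lemma transition_mem E a x y : transition E a x = Some y -> (x, a, y) \in E.
Proof.
rewrite /transition; case F: [seq e.2 | e <- _] => [|z s] // [<-].
have : z \in [seq e.2 | e <- [seq e <- E | e.1 == (x, a)]].
  by rewrite F mem_head.
by case/mapP => -[p q]; rewrite mem_filter /= => /andP[/eqP-> ?] ->.
Qed.

Lemma mem_transition E a x y :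
  (forall z, (x, a, z) \in E -> z = y) -> (x, a, y) \in E ->
  transition E a x = Some y.
Proof.
move=> uniq_y xy; case F: (transition E a x) => [z|].
  by rewrite (uniq_y z) // transition_mem.
move: F; rewrite /transition; case F: [seq e.2 | e <- _] => [|//] _.
have : y \in [seq e.2 | e <- [seq e <- E | e.1 == (x, a)]].
  by apply/mapP; exists (x, a, y); rewrite // mem_filter eqxx.
by rewrite F.
Qed.

Definition signed_product gs (g : FG) (c : seq FG) : bool :=
  all (fun h => (h \in gs) || (h^-1 \in gs)) c && (g == foldr *%g 1 c).

Definition edge_label (e : edge) : FG := e.2^-1 * (fg_of [:: e.1.2] * e.1.1).

Definition edges (C : seq (edge * seq FG)) : seq edge := [seq ec.1 | ec <- C].

(** The list attached to an edge writes its label as a product of generators and their inverses,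
    which makes membership in H checkable. The symmetry test yields an involutive action even though
    a table is an arbitrary list. *)
Definition certified gs (C : seq (edge * seq FG)) : bool :=
  [&& all (fun ec => signed_product gs (edge_label ec.1) ec.2) C,
      all (fun e => transition (edges C) (inv_letter e.1.2) e.2 == Some e.1.1)
        (edges C),
      all (fun g => run (transition (edges C)) (word g) 1 == Some 1) gs
    & all (fun a => transition (edges C) a 1 != None) (enum {: letter n})].

Lemma signed_product_generated gs g c :
  signed_product gs g c -> generated (fun x => x \in gs) g.
Proof.
have sG := generated_subgroup (fun x => x \in gs).
case/andP => + /eqP->; elim: c => [_|h c IHc /=]; first exact: subgroup1 sG.
case/andP => hgs /IHc; apply: (subgroupM sG).
case/orP: hgs => hgs; first exact: generated_incl.
by rewrite -[h]invgK; apply: (subgroupV sG); apply: generated_incl.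
Qed.

Lemma generated_signed_product gs g :
  generated (fun x => x \in gs) g -> exists c, signed_product gs g c.
Proof.
move=> gg; apply: (gg (fun g => exists c, signed_product gs g c)); last first.
  by move=> x xgs; exists [:: x]; rewrite /signed_product /= xgs mulg1 eqxx.
have foldrM (c d : seq FG) : foldr *%g 1 (c ++ d) = foldr *%g 1 c * foldr *%g 1 d.
  by elim: c => [|x c IHc] /=; rewrite ?mul1g // IHc mulgA.
split.
- by exists [::]; rewrite /signed_product eqxx.
- move=> x y [c /andP[cgs /eqP->]] [d /andP[dgs /eqP->]]; exists (c ++ d).
  by rewrite /signed_product all_cat cgs dgs foldrM eqxx.
- move=> x [c /andP[cgs /eqP->]]; exists (rev [seq h^-1 | h <- c]).
  rewrite /signed_product all_rev all_map; apply/andP; split.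
    by apply: sub_all cgs => h /=; rewrite invgK orbC.
  apply/eqP; elim: c {cgs} => [|h c IHc] /=; first by rewrite invg1.
  by rewrite rev_cons -cats1 foldrM -IHc /= mulg1 invgM.
Qed.

Lemma certified_coset_action gs C (H : FG -> Prop) :
  is_subgroup H -> generated_by gs H -> certified gs C ->
  coset_action H (transition (edges C)) (states (edges C)).
Proof.
move=> sH genH /and4P[/allP sound /allP sym /allP gens /allP hair].
have dV : involutive_action (transition (edges C)).
  by move=> a x y /transition_mem/sym/eqP.
split=> //.
- move=> a x y /transition_mem/mapP[[e c] eC /= ee].
  by apply/genH; have := signed_product_generated (sound _ eC); rewrite -ee.
- move=> h /genH; apply; first exact: stabilizer_subgroup.
  by move=> g /gens/eqP.
- by move=> a; have := hair a; rewrite mem_enum; case: transition => // /(_ isT).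
- by move=> a x y /transition_mem xy; rewrite inE; apply/orP; right; apply: map_f xy.
Qed.

(** * Existence of a certified table *)

Section Existence.
Variable gs : seq FG.

Let H : FG -> Prop := generated (fun x => x \in gs).
Let sH : is_subgroup H := generated_subgroup _.

Let same_coset (x y : FG) : Prop := H (x^-1 * y).

Let same_coset_refl x : same_coset x x.
Proof. by rewrite /same_coset mulVg; apply: subgroup1. Qed.

Let same_coset_sym x y : same_coset x y -> same_coset y x.
Proof. by move=> /(subgroupV sH); rewrite /same_coset invgM invgK. Qed.

Let same_coset_trans x y z : same_coset x y -> same_coset y z -> same_coset x z.
Proof.
by move=> xy yz; have := subgroupM sH xy yz; rewrite -mulgA mulVKg.
Qed.

Let same_coset_mul g x y : same_coset x y -> same_coset (g * x) (g * y).
Proof. by rewrite /same_coset invgM -mulgA mulKg. Qed.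

(** Reading a generator from the right passes through its suffixes, and the letters make each of
    them readable at 1. The element 1 comes first so that it represents its own coset. *)
Let points : seq FG := 1 :: [seq fg_of [:: a] | a <- enum {: letter n}] ++
  flatten [seq [seq fg_of (drop i (word g)) | i <- iota 0 (size (word g)).+1]
          | g <- gs].

(** Cosets are compared classically: only the existence of a table is at stake here, not its
    computation. *)
Let repr x := nth 1 points (find (fun y => `[< same_coset y x >]) points).

Let repr_same_coset x : x \in points -> same_coset (repr x) x.
Proof.
move=> xP; apply/asboolP; apply: (@nth_find _ _ (fun y => `[< same_coset y x >])).
apply/hasP; exists x; first exact: xP.
by apply/asboolP; exact: same_coset_refl.
Qed.

Let repr_eq x y : same_coset x y -> repr x = repr y.
Proof.
move=> xy; rewrite /repr; congr (nth _ _ _); apply: eq_find => z.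
apply/asboolP/asboolP => zx; first exact: same_coset_trans zx xy.
exact: same_coset_trans zx (same_coset_sym xy).
Qed.

Let repr1 : repr 1 = 1.
Proof.
rewrite /repr /points /=.
by have -> : `[< same_coset 1 1 >] by apply/asboolP; exact: same_coset_refl.
Qed.

(** The Schreier graph on left cosets of H, restricted to the cosets of [points]. *)
Let E : seq edge :=
  [seq e <- [seq (xa, y) |
             xa <- [seq (x, a) | x <- map repr points, a <- enum {: letter n}],
             y <- map repr points]
         | `[< H (edge_label e) >]].

Let mem_E x a y : x \in points -> y \in points ->
  same_coset y (fg_of [:: a] * x) -> (repr x, a, repr y) \in E.
Proof.
move=> xP yP yax; rewrite mem_filter; apply/andP; split.
  apply/asboolP; apply: same_coset_trans (repr_same_coset yP) _.
  apply: same_coset_trans yax _; apply: same_coset_mul.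
  by apply: same_coset_sym; apply: repr_same_coset.
apply/allpairsP; exists ((repr x, a), repr y); split; [|exact: (map_f repr yP)|by []].
apply/allpairsP; exists (repr x, a); split; last by [].
  exact: (map_f repr xP).
by rewrite mem_enum.
Qed.

Let E_mem x a y : (x, a, y) \in E ->
  [/\ exists2 x', x' \in points & x = repr x',
      exists2 y', y' \in points & y = repr y'
    & same_coset y (fg_of [:: a] * x)].
Proof.
rewrite mem_filter => /andP[/asboolP h /allpairsP[[xa y0] []]].
case/allpairsP => -[x0 a0] [/mapP[x' x'P e1] _ e2] /mapP[y' y'P e3] [e4 e5].
rewrite /= in e1 e2 e3 e4 e5; move: e4; rewrite e2 e1 => -[ex _].
by split=> //; [exists x' | exists y'; rewrite ?e5].
Qed.

Let repr_repr x : x \in points -> repr (repr x) = repr x.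
Proof. by move=> /repr_same_coset/repr_eq. Qed.

Let E_deterministic x a y z : (x, a, y) \in E -> (x, a, z) \in E -> z = y.
Proof.
move=> /E_mem[_ [y' y'P ->] yx] /E_mem[_ [z' z'P ->] zx].
rewrite -(repr_repr y'P) -(repr_repr z'P); apply: repr_eq.
exact: same_coset_trans zx (same_coset_sym yx).
Qed.

Let transitionE x a y : (x, a, y) \in E -> transition E a x = Some y.
Proof.
by move=> xy; apply: mem_transition => // z; apply: E_deterministic.
Qed.

Let run_points w : (forall i, fg_of (drop i w) \in points) ->
  run (transition E) w 1 = Some (repr (fg_of w)).
Proof.
elim: w => [|a w IHw] wP; first by rewrite fg_of_nil repr1.
rewrite /run /= -/(run _ _ _) IHw /=; last by move=> i; apply: (wP i.+1).
apply: transitionE; apply: mem_E; first by have := wP 1%N; rewrite /= drop0.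
  exact: (wP 0%N).
by rewrite -(cat1s a w) fg_of_cat.
Qed.

Lemma exists_certified : exists C, certified gs C.
Proof.
have [C CE CS] : exists2 C, edges C = E &
    all (fun ec => signed_product gs (edge_label ec.1) ec.2) C.
  have : {in E, forall e, H (edge_label e)}.
    by move=> e; rewrite mem_filter => /andP[/asboolP].
  elim: E => [|e s IHs] eH; first by exists [::].
  have [|C <- CS] := IHs; first by move=> e' e's; apply: eH; rewrite inE e's orbT.
  have /generated_signed_product[c ec] := eH e (mem_head _ _).
  by exists ((e, c) :: C); rewrite //= ec.
have one_points : 1 \in points by rewrite /points mem_head.
exists C; rewrite /certified CS CE /=; apply/and3P; split; apply/allP.
- move=> [[x a] y] xy /=; apply/eqP; apply: transitionE.
  have [[x' x'P ex] [y' y'P ey] yax] := E_mem xy.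
  rewrite ex ey in yax *; apply: mem_E => //.
  apply: same_coset_trans (same_coset_sym (repr_same_coset x'P)) _.
  apply: same_coset_trans (same_coset_mul _ (repr_same_coset y'P)).
  have := same_coset_mul (fg_of [:: inv_letter a]) (same_coset_sym yax).
  by rewrite fg_of_inv_letter mulKg.
- move=> g ggs; rewrite run_points => [|i].
    apply/eqP; rewrite fg_ofK -[in RHS]repr1; congr Some; apply: repr_eq.
    apply: same_coset_sym; rewrite /same_coset invg1 mul1g.
    exact: generated_incl.
  rewrite inE mem_cat; apply/orP; right; apply/orP; right.
  apply/flattenP; exists [seq fg_of (drop i (word g)) | i <- iota 0 (size (word g)).+1].
    exact: map_f.
  have [lei|lti] := leqP i (size (word g)).
    by apply/mapP; exists i => //; rewrite mem_iota.
  apply/mapP; exists (size (word g)); first by rewrite mem_iota leqnn.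
  by rewrite drop_size drop_oversize // ltnW.
- move=> a _; rewrite -[transition E a 1]/(run (transition E) [:: a] 1).
  rewrite run_points // => -[|i]; last by rewrite /= fg_of_nil.
  rewrite inE mem_cat; apply/orP; right; apply/orP; left.
  by apply/mapP; exists a; rewrite ?mem_enum.
Qed.

End Existence.

End Certificates.

(** * Computability of coset actions *)

Section WordComputability.
Variables (n : nat) (C : countType).
Local Notation FG := (free_group n).
Local Notation edge := (FG * letter n * FG)%type.
Implicit Types (u v : C -> seq (letter n)) (g h : C -> FG).

Lemma computable_inv_letter (a : C -> letter n) :
  computable a -> computable (fun c => inv_letter (a c)).
Proof. exact: computable_fun_fin. Qed.

Lemma computable_word g : computable g -> computable (fun c => word (g c)).
Proof. exact: computable_same_code. Qed.

Lemma computable_of_word g : computable (fun c => word (g c)) -> computable g.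
Proof. by case=> f rf fE; exists f. Qed.

End WordComputability.

Section FreeGroupComputability.
Variables (n : nat) (C : countType).
Local Notation FG := (free_group n).
Local Notation edge := (FG * letter n * FG)%type.
Implicit Types (u v : C -> seq (letter n)) (g h : C -> FG).

Lemma computable_mul_word u v :
  computable u -> computable v -> computable (fun c => mul_word (u c) (v c)).
Proof.
move=> cu cv; rewrite /mul_word; computability; rewrite /push; computability.
by apply: computable_inv_letter; computability.
Qed.

Lemma computable_fg_of u : computable u -> computable (fun c => fg_of (u c)).
Proof.
move=> cu; apply: computable_of_word => /=.
by apply: computable_mul_word; computability.
Qed.

Lemma computable_mulg g h :
  computable g -> computable h -> computable (fun c => g c * h c).
Proof.
move=> cg ch; apply: computable_of_word => /=.
by apply: computable_mul_word; apply: computable_word.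
Qed.

Lemma computable_invg g : computable g -> computable (fun c => (g c)^-1).
Proof.
move=> cg; apply: computable_of_word; rewrite /= /inv_word; computability.
exact: computable_word.
Qed.

Lemma computable_obind (T U : countType) (f : C -> T -> option U)
    (x : C -> option T) :
  computable (fun p : C * T => f p.1 p.2) -> computable x ->
  computable (fun c => obind (f c) (x c)).
Proof. by move=> cf cx; rewrite /obind /oapp; computability. Qed.

Lemma computable_transition (E : C -> seq edge) (a : C -> letter n) (x : C -> FG) :
  computable E -> computable a -> computable x ->
  computable (fun c => transition (E c) (a c) (x c)).
Proof.
move=> cE ca cx; by rewrite /transition; computability.
Qed.

End FreeGroupComputability.

Ltac free_group_step :=
  match goal with
  | |- computable (fun c => inv_letter _) => apply: computable_inv_letter
  | |- computable (fun c => word _) => apply: computable_word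
  | |- computable (fun c => mul_word _ _) => apply: computable_mul_word
  | |- computable (fun c => fg_of _) => apply: computable_fg_of
  | |- computable (fun c => mul _ _) => apply: computable_mulg
  | |- computable (fun c => inv _) => apply: computable_invg
  | |- computable (fun c => obind _ _) => apply: computable_obind
  | |- computable (fun c => transition _ _ _) => apply: computable_transition
  end.
Ltac computability ::=
  repeat (cbv beta; first [free_group_step | computability_list_step
                          | computability_step | computability_option_step]).

Section Automata.
Variable n : nat.
Local Notation FG := (free_group n).
Local Notation edge := (FG * letter n * FG)%type.

Lemma computable_run (C : countType) (E : C -> seq edge)
    (w : C -> seq (letter n)) (x : C -> FG) :
  computable E -> computable w -> computable x ->
  computable (fun c => run (transition (E c)) (w c) (x c)).
Proof.
move=> cE cw cx; by rewrite /run; computability.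
Qed.

Lemma computable_certified :
  computable (fun p : seq FG * seq (edge * seq FG) => certified p.1 p.2).
Proof.
rewrite /certified /signed_product /edge_label /edges; computability.
by apply: computable_run; computability.
Qed.

Lemma decodable_free_group : decodable FG.
Proof.
have cf : computable (@fg_of n) by apply: computable_fg_of; apply: computable_id.
apply: (decodable_same_code cf (@fg_ofK n)) => //.
exact/decodable_seq/decodable_fin.
Qed.

Lemma exists_computable_automaton :
  exists2 aut : seq FG -> seq edge, computable aut &
    forall gs (H : FG -> Prop), is_subgroup H -> generated_by gs H ->
      coset_action H (transition (aut gs)) (states (aut gs)).
Proof.
have dC : decodable (seq FG) by exact/decodable_seq/decodable_free_group.
have dT : decodable (seq (edge * seq FG)).
  apply: decodable_seq; apply: decodable_prod dC.
  apply: decodable_prod; last exact: decodable_free_group.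
  by apply: decodable_prod; [exact: decodable_free_group | exact: decodable_fin].
have [f cf fP] := computable_search [::] [::] dC dT computable_certified
  (@exists_certified n).
exists (fun gs => edges (f gs)) => [|gs H sH genH].
  by rewrite /edges; computability.
exact: certified_coset_action sH genH (fP gs).
Qed.

End Automata.

(** * The grammar of cocycles *)

Section Words.
Variable T : countType.

Definition words_of_size (m : nat) (A : seq T) : seq (seq T) :=
  iter m (fun S => [seq x :: s | x <- A, s <- S]) [:: [::]].

Lemma mem_words_of_size (A s : seq T) :
  {subset s <= A} -> s \in words_of_size (size s) A.
Proof.
elim: s => [|x s IHs] sA //=; apply/allpairsP; exists (x, s); split=> //=.
  by apply: sA; rewrite mem_head.
by apply: IHs => y ys; apply: sA; rewrite inE ys orbT.
Qed.

End Words.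

Section CocycleGrammar.
Variable n : nat.
Local Notation FG := (free_group n).
Local Notation edge := (FG * letter n * FG)%type.
Local Notation kind := (bool * option (letter n) * option (letter n))%type.
Local Notation prof := (kind * seq (option FG))%type.

Section Acceptance.
Variables (E : seq edge) (good : seq (FG * FG)).
Local Notation Q := (states E).
Local Notation tr := (transition E).

(* The table of a word lists its action on the states, in their order. *)
Definition init_profile : prof := (kind_of [::], [seq Some x | x <- Q]).

Definition step_profile (a : letter n) (p : prof) : prof :=
  (kmul (kind_of [:: a]) p.1, [seq obind (tr a) x | x <- p.2]).

(** An explicit finite set closed under steps. It may contain profiles of no word; these are
    harmless, since derivations start from [init_profile]. *)
Definition all_profiles : seq prof :=
  [seq (k, t) | k <- enum {: kind},
                t <- words_of_size (size Q) (None :: [seq Some x | x <- Q])].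

Definition lookup (t : seq (option FG)) (z : option FG) : option FG :=
  obind (fun x => nth None t (find (pred1 x) Q)) z.

(** The criterion for cocycles on profiles: s^-1 w s and w w are reduced, the end states form a good
    pair, and w is empty or leaves the states. If s cannot be read at 1, then [x] is [None] and no
    pair passes. *)
Definition accepting (ps p1 p2 : prof) : bool :=
  let x := lookup ps.2 (Some 1) in
  let kw := kmul p1.1 p2.1 in
  [&& (kmul (kinv ps.1) (kmul kw ps.1)).1.1, (kmul kw kw).1.1,
      has (fun ab => (lookup p2.2 x == Some ab.1) &&
                     (lookup p1.2 (Some ab.2) == x)) good
    & (kw == kind_of [::]) ||
      (iter (size Q) (fun z => lookup p1.2 (lookup p2.2 z)) x == None)].

Local Notation pf := (profile init_profile step_profile).

Lemma profileE w : pf w = (kind_of w, [seq run tr w x | x <- Q]).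
Proof.
elim: w => [|a w IHw] //; rewrite [LHS]/(step_profile a (pf w)) IHw.
by rewrite /step_profile -kind_of_cat -map_comp.
Qed.

Lemma init_in_all : init_profile \in all_profiles.
Proof.
apply/allpairsP; exists init_profile; rewrite mem_enum; split=> //.
rewrite -[size Q](size_map Some); apply: mem_words_of_size => z zs.
by rewrite inE zs orbT.
Qed.

Lemma size_words_of_size (T : countType) m (A s : seq T) :
  s \in words_of_size m A -> size s = m.
Proof.
elim: m s => [|m IHm] s /=; first by rewrite inE => /eqP->.
by case/allpairsP => -[x t] [_ /IHm /= <- ->].
Qed.

Lemma step_in_all a p : p \in all_profiles -> step_profile a p \in all_profiles.
Proof.
case/allpairsP => -[k t] [_ /size_words_of_size st ->].
have {}st : size t = size Q := st.
apply/allpairsP; exists (step_profile a (k, t)); rewrite mem_enum; split=> //.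
rewrite -st -(size_map (obind (tr a)) t); apply: mem_words_of_size => z.
have trQ y : tr a y \in None :: [seq Some x | x <- Q].
  case F: (tr a y) => [y'|] //; rewrite inE; apply/orP; right; apply: map_f.
  by rewrite inE (map_f _ (transition_mem F)) orbT.
by case/mapP => -[y|] _ ->; [apply: trQ | rewrite mem_head].
Qed.

Lemma lookup_profile w x : x \in Q -> lookup (pf w).2 (Some x) = run tr w x.
Proof.
move=> xQ; rewrite profileE.
change (nth None [seq run tr w y | y <- Q] (find (pred1 x) Q) = run tr w x).
rewrite (nth_map 1); last by rewrite -has_find has_pred1.
by congr run; apply/eqP; apply: (@nth_find _ 1 (pred1 x)); rewrite has_pred1.
Qed.

Lemma kind_of_nil (w : seq (letter n)) : (kind_of w == kind_of [::]) = (w == [::]).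
Proof. by case: w => [|a w]; rewrite ?eqxx // /kind_of !xpair_eqE andbF. Qed.

Variable H : FG -> Prop.
Hypotheses (sH : is_subgroup H) (act : coset_action H tr Q).
Hypothesis goodP : forall a b, (a, b) \in good <->
  [/\ a \in Q, b \in Q & spans H (b^-1 * a)].

Lemma acceptingP s w1 w2 :
  accepting (pf s) (pf w1) (pf w2) <->
  reduced (inv_word s ++ (w1 ++ w2) ++ s) /\ exists x a b,
  [/\ reduced ((w1 ++ w2) ++ w1 ++ w2),
      [/\ run tr s 1 = Some x, run tr w2 x = Some a & run tr w1 b = Some x],
      [/\ a \in Q, b \in Q & spans H (b^-1 * a)]
    & w1 ++ w2 = [::] \/ iter_run tr (w1 ++ w2) (size Q) (Some x) = None].
Proof.
have base := coset_action_base act.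
have inQ := @run_target _ _ tr Q (coset_action_states act).
rewrite /accepting lookup_profile //.
have -> : (pf s).1 = kind_of s by rewrite profileE.
have -> : (pf w1).1 = kind_of w1 by rewrite profileE.
have -> : (pf w2).1 = kind_of w2 by rewrite profileE.
rewrite -kind_of_inv -!kind_of_cat kind_of_nil.
have iterE x : x \in Q ->
    iter (size Q) (fun z => lookup (pf w1).2 (lookup (pf w2).2 z)) (Some x) =
    iter_run tr (w1 ++ w2) (size Q) (Some x).
  move=> xQ; elim: (size Q) => // m IHm; rewrite iterS IHm /iter_run iterS.
  rewrite -/(iter_run _ _ _ _); case F: (iter_run _ _ _ _) => [y|] //.
  have yQ : y \in Q by move: F; rewrite -run_power => /inQ; apply.
  rewrite lookup_profile //.
  change (lookup (pf w1).2 (run tr w2 y) = run tr (w1 ++ w2) y); rewrite run_cat.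
  by case G: (run tr w2 y) => [z|] //; rewrite lookup_profile ?(inQ _ _ _ yQ G).
split.
- case/and4P=> ru rw /hasP[[a b] /goodP[aQ bQ sp]] /andP[/eqP w2x /eqP w1b] out.
  change (lookup (pf w2).2 (run tr s 1) = Some a) in w2x.
  change (lookup (pf w1).2 (Some b) = run tr s 1) in w1b.
  split=> //; move: w2x w1b out; case F: (run tr s 1) => [x|] //.
  have xQ := inQ _ _ _ base F.
  rewrite !lookup_profile // iterE // => w2x w1b out.
  exists x, a, b; split=> //.
  by case/orP: out => /eqP; [left | right].
case=> ru [x [a [b [rw [sx w2x w1b] [aQ bQ sp] out]]]].
have xQ := inQ _ _ _ base sx.
apply/and4P; split=> //.
  apply/hasP; exists (a, b); first exact/goodP.
  change ((lookup (pf w2).2 (run tr s 1) == Some a) &&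
          (lookup (pf w1).2 (Some b) == run tr s 1)).
  by rewrite sx !lookup_profile // w2x w1b !eqxx.
by rewrite sx iterE //; apply/orP; case: out => /eqP; [left | right].
Qed.

Theorem cocycle_grammarP :
  generates_subset
    (profile_grammar all_profiles init_profile step_profile accepting)
    (oplus_cocycle H).
Proof.
move=> z; rewrite (profile_grammarP accepting init_in_all step_in_all).
split=> [[s [w1 [w2 [-> /acceptingP[ru [x [a [b [rw rs ab out]]]]]]]]]|[u uC ->]].
  exists (fg_of (inv_word s ++ (w1 ++ w2) ++ s)); last by rewrite word_fg_of.
  apply/(oplus_cocycleP sH act); exists s, w1, w2, x, a, b; split=> //.
  by rewrite word_fg_of.
have /(oplus_cocycleP sH act)[s [w1 [w2 [x [a [b [[eu rw] rs ab out]]]]]]] := uC.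
exists s, w1, w2; split=> //; apply/acceptingP; split; first by rewrite -eu wordP.
by exists x, a, b.
Qed.

End Acceptance.
Definition all_loops (E : seq edge) : bool :=
  all (fun a => transition E a 1 == Some 1) (enum {: letter n}).

(** If all letters fix 1, so do all words, and the stabilizer of 1 is H. *)
Lemma all_loopsP (H : FG -> Prop) (E : seq edge) : is_subgroup H ->
  coset_action H (transition E) (states E) -> all_loops E <-> forall g, H g.
Proof.
move=> sH act; split=> [/allP loops g|HT].
  apply/(stabilizerE sH act); apply: run_letters => a.
  by apply/eqP/loops; rewrite mem_enum.
apply/allP => a _; apply/eqP.
exact: (coset_action_complete act (HT (fg_of [:: a]))).
Qed.

Lemma spans_generated_cons (H : FG -> Prop) gs u : generated_by gs H ->
  spans H u <-> forall g, generated (fun x => x \in u :: gs) g.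
Proof.
move=> genH; split=> sp g; apply: generated_sub (sp g) => x.
  case=> [/genH|->]; last by apply: generated_incl; rewrite mem_head.
  apply: generated_sub => y ygs; apply: generated_incl.
  by rewrite inE ygs orbT.
rewrite inE => /orP[/eqP->|xgs]; apply: generated_incl; [by right | left].
by apply/genH; apply: generated_incl.
Qed.

(** The automaton is built anew for the generators together with b^-1 a; its loops at 1 decide
    whether they generate the whole group. *)
Definition good_pairs (aut : seq FG -> seq edge) (gs : seq FG) : seq (FG * FG) :=
  [seq ab <- [seq (a, b) | a <- states (aut gs), b <- states (aut gs)]
         | all_loops (aut (ab.2^-1 * ab.1 :: gs))].

Definition cocycle_grammar (E : seq edge) (good : seq (FG * FG)) :=
  profile_grammar (all_profiles E) (init_profile E) (step_profile E)
    (accepting E good).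

Lemma computable_good_pairs (aut : seq FG -> seq edge) :
  computable aut -> computable (good_pairs aut).
Proof. by move=> caut; rewrite /good_pairs /all_loops /states; computability. Qed.

Lemma computable_kind_of1 (C : countType) (a : C -> letter n) :
  computable a -> computable (fun c => kind_of [:: a c]).
Proof. exact: (computable_fun_fin (fun a => kind_of [:: a])). Qed.

Lemma computable_kinv (C : countType) (k : C -> kind) :
  computable k -> computable (fun c => kinv (k c)).
Proof. exact: computable_fun_fin. Qed.

Lemma computable_kmul (C : countType) (k k' : C -> kind) :
  computable k -> computable k' -> computable (fun c => kmul (k c) (k' c)).
Proof.
move=> ck ck'.
exact: (computable_fun_fin (fun kk => kmul kk.1 kk.2) (computable_pair ck ck')).
Qed.

Lemma computable_states (C : countType) (E : C -> seq edge) :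
  computable E -> computable (fun c => states (E c)).
Proof. by move=> cE; rewrite /states; computability. Qed.

Lemma computable_words_of_size (C T : countType) (m : C -> nat) (A : C -> seq T) :
  computable m -> computable A -> computable (fun c => words_of_size (m c) (A c)).
Proof. by move=> cm cA; rewrite /words_of_size; computability. Qed.

Lemma computable_lookup (C : countType) (E : C -> seq edge)
    (t : C -> seq (option FG)) (z : C -> option FG) :
  computable E -> computable t -> computable z ->
  computable (fun c => lookup (E c) (t c) (z c)).
Proof.
move=> cE ct cz; rewrite /lookup /states; computability.
by rewrite /pred1 /=; computability.
Qed.

End CocycleGrammar.

Ltac profile_step :=
  match goal with
  | |- computable (fun c => kind_of _) => apply: computable_kind_of1
  | |- computable (fun c => kinv _) => apply: computable_kinv
  | |- computable (fun c => kmul _ _) => apply: computable_kmul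
  | |- computable (fun c => states _) => apply: computable_states
  | |- computable (fun c => words_of_size _ _) => apply: computable_words_of_size
  | |- computable (fun c => lookup _ _ _) => apply: computable_lookup
  end.
Ltac computability ::=
  repeat (cbv beta; first [profile_step | free_group_step | computability_list_step
                          | computability_step | computability_option_step]).

(** * Computability of the grammar of cocycles *)

Section GrammarComputability.
Variable n : nat.
Local Notation FG := (free_group n).
Local Notation edge := (FG * letter n * FG)%type.
Local Notation kind := (bool * option (letter n) * option (letter n))%type.
Local Notation prof := (kind * seq (option FG))%type.

Lemma computable_all_profiles (C : countType) (E : C -> seq edge) :
  computable E -> computable (fun c => all_profiles (E c)).
Proof. by move=> cE; rewrite /all_profiles; computability. Qed.

Lemma computable_init_profile (C : countType) (E : C -> seq edge) :
  computable E -> computable (fun c => init_profile (E c)).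
Proof. by move=> cE; rewrite /init_profile; computability. Qed.

Lemma computable_step_profile (C : countType) (E : C -> seq edge)
    (a : C -> letter n) (p : C -> prof) :
  computable E -> computable a -> computable p ->
  computable (fun c => step_profile (E c) (a c) (p c)).
Proof. by move=> cE ca cp; rewrite /step_profile; computability. Qed.

Lemma computable_accepting (C : countType) (E : C -> seq edge)
    (good : C -> seq (FG * FG)) (ps p1 p2 : C -> prof) :
  computable E -> computable good ->
  computable ps -> computable p1 -> computable p2 ->
  computable (fun c => accepting (E c) (good c) (ps c) (p1 c) (p2 c)).
Proof.
by move=> cE cg cs c1 c2; rewrite /accepting; cbv zeta; computability.
Qed.

Lemma computable_profile_pairs (C P : countType) (U : C -> seq P) :
  computable U -> computable (fun c => profile_pairs (U c)).
Proof. by move=> cU; rewrite /profile_pairs; computability. Qed.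

Lemma computable_profile_triples (C P : countType) (U : C -> seq P) :
  computable U -> computable (fun c => profile_triples (U c)).
Proof.
move=> cU; rewrite /profile_triples; computability.
by apply: computable_profile_pairs; computability.
Qed.

End GrammarComputability.

Ltac grammar_step :=
  match goal with
  | |- computable (fun c => all_profiles _) => apply: computable_all_profiles
  | |- computable (fun c => init_profile _) => apply: computable_init_profile
  | |- computable (fun c => step_profile _ _ _) => apply: computable_step_profile
  | |- computable (fun c => accepting _ _ _ _ _) => apply: computable_accepting
  | |- computable (fun c => profile_pairs _) => apply: computable_profile_pairs
  | |- computable (fun c => profile_triples _) =>
    apply: computable_profile_triples
  end.
Ltac computability ::=
  repeat (cbv beta; first [grammar_step | profile_step | free_group_step
                          | computability_list_step | computability_step
                          | computability_option_step]).

Lemma computable_cocycle_grammar (n : nat) (C : countType)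
    (E : C -> seq (free_group n * letter n * free_group n))
    (good : C -> seq (free_group n * free_group n)) :
  computable E -> computable good ->
  computable (fun c => cocycle_grammar (E c) (good c)).
Proof.
move=> cE cg.
suff h : computable (fun c => (start (cocycle_grammar (E c) (good c)),
    productions (cocycle_grammar (E c) (good c)))).
  by case: h => f rf fE; exists f.
rewrite /cocycle_grammar /= /profile_productions /wrap_productions
  /enter2_productions /grow2_productions /enter1_productions /grow1_productions
  /stop_productions /profile_nt.
by computability.
Qed.

Theorem proposition7p6 (n : nat) :
  (forall H : free_group n -> Prop,
     is_subgroup H -> finitely_generated H -> context_free (oplus_cocycle H)) /\
  (exists f : seq (free_group n) -> grammar (letter n),
     computable f /\
     forall (H : free_group n -> Prop) (gs : seq (free_group n)),
       is_subgroup H -> generated_by gs H ->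
       generates_subset (f gs) (oplus_cocycle H)).
Proof.
have [aut caut autP] := exists_computable_automaton n.
pose f gs := cocycle_grammar (aut gs) (good_pairs aut gs).
have fP (H : free_group n -> Prop) gs : is_subgroup H -> generated_by gs H ->
    generates_subset (f gs) (oplus_cocycle H).
  move=> sH genH; apply: cocycle_grammarP sH (autP _ _ sH genH) _ => a b.
  have sK := generated_subgroup (fun x => x \in (b^-1 * a)%g :: gs).
  have act := autP _ _ sK (fun g => iff_refl _).
  have loopsE : all_loops (aut ((b^-1 * a)%g :: gs)) <-> spans H (b^-1 * a)%g.
    apply: (iff_trans (all_loopsP sK act)); apply: iff_sym.
    exact: spans_generated_cons.
  rewrite mem_filter; split.
    case/andP => /loopsE sp /allpairsP[[a' b'] [/= aQ bQ [ea eb]]].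
    by rewrite -ea -eb in aQ bQ.
  by case=> aQ bQ /loopsE ->; apply/allpairsP; exists (a, b).
split=> [H sH [gs genH]|]; first by exists (f gs); apply: fP.
exists f; split=> //; apply: computable_cocycle_grammar => //.
exact: computable_good_pairs.
Qed.
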